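(* Under assumptions (A1), (A2) and (A3) of the context, assume that $X$, $Y$ are compact sets, $\gamma_1>0$, $\gamma_2>0$, $c>0$ and $\eta_k\in\big(\underline{\eta},\,1/(L_f+rL_{g_2}+1/\gamma_1)\big)$ with $\underline{\eta}>0$. Then there exists $c_\alpha>0$ such that when $\alpha_k\in(\underline{\alpha},c_\alpha)$ with $\underline{\alpha}>0$, the sequence $(x^k,y^k,z^k,\theta^k,\lambda^k)$ generated by the algorithm BiC-GAFFA with constant penalty parameter $c_k=c$ satisfies $$\min_{0\le k\le K}R(x^{k+1},y^{k+1},z^{k+1})=O\Big(\frac{1}{K^{1/2}}\Big).$$
   Context: $X\subseteq\mathbb{R}^n$ and $Y\subseteq\mathbb{R}^m$ are closed convex sets, $Z:=[0,r]^p$ with $r\ge0$; $F,f:X\times Y\to\mathbb{R}$ and $g:X\times Y\to\mathbb{R}^p$ are continuously differentiable. (A1) $F$ is $L_F$-smooth on $X\times Y$ (i.e. $\nabla F$ is $L_F$-Lipschitz there) and $\underline{F}:=\inf_{(x,y)\in X\times Y}F(x,y)>-\infty$. (A2) For each $x\in X$, $f$ is convex with respect to $y$ on $Y$; $f$ is continuously differentiable on an open set containing $X\times Y$ and is $L_f$-smooth on $X\times Y$. (A3) For each $x\in X$, $g$ is convex (componentwise) with respect to $y$ on $Y$; $g$ is $L_g$-Lipschitz continuous on $X\times Y$; $g$ is continuously differentiable on an open set containing $X\times Y$, and $\nabla_x g$ and $\nabla_y g$ are $L_{g_1}$- and $L_{g_2}$-Lipschitz continuous on $X\times Y$, respectively.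 Gap function: with $\mathcal{L}(x,y,z)=f(x,y)+z^{T}g(x,y)$ and $\gamma=(\gamma_1,\gamma_2)$, $$\mathcal{G}_{\gamma}(x,y,z):=\max_{\theta\in Y,\,\lambda\in\mathbb{R}^p_+}\Big\{\mathcal{L}(x,y,\lambda)-\tfrac{1}{2\gamma_2}\|\lambda-z\|^2-\mathcal{L}(x,\theta,z)-\tfrac{1}{2\gamma_1}\|\theta-y\|^2\Big\}.$$ It is continuously differentiable on $X\times Y\times\mathbb{R}^p_+$, with gradient components $\nabla_x\mathcal{G}_\gamma=\nabla_x f(x,y)+(\lambda^* )^{T}\nabla_x g(x,y)-\nabla_x f(x,\theta^* )-z^{T}\nabla_x g(x,\theta^* )$, $\nabla_y\mathcal{G}_\gamma=\nabla_y f(x,y)+(\lambda^* )^{T}\nabla_y g(x,y)-(y-\theta^* )/\gamma_1$, $\nabla_z\mathcal{G}_\gamma=-(z-\lambda^* )/\gamma_2-g(x,\theta^* )$, where $\theta^*=\operatorname{argmin}_{\theta\in Y}\{f(x,\theta)+z^{T}g(x,\theta)+\frac{1}{2\gamma_1}\|\theta-y\|^2\}$ and $\lambda^*=\mathrm{Proj}_{\mathbb{R}^p_+}(z+\gamma_2 g(x,y))$. Let $\psi_c(x,y,z):=F(x,y)+c\,\mathcal{G}_\gamma(x,y,z)$ and $$R(x,y,z):=\mathrm{dist}\big(0,\nabla\psi_c(x,y,z)+\mathcal{N}_{X\times Y\times Z}(x,y,z)\big),$$ with $\mathcal{N}$ the normal cone. Algorithm BiC-GAFFA: start from $(x^0,y^0,z^0)\in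 X\times Y\times Z$, $\theta^0\in Y$, with stepsizes $\alpha_k,\eta_k>0$ and penalty parameters $c_k$. For $k=0,1,2,\dots$: $d_\theta^k=\nabla_y f(x^k,\theta^k)+(z^k)^{T}\nabla_y g(x^k,\theta^k)+\frac1{\gamma_1}(\theta^k-y^k)$; $\theta^{k+1}=\mathrm{Proj}_Y(\theta^k-\eta_k d_\theta^k)$, $\lambda^{k+1}=\mathrm{Proj}_{\mathbb{R}^p_+}(z^k+\gamma_2 g(x^k,y^k))$; $d_x^k=\frac1{c_k}\nabla_xF(x^k,y^k)+\nabla_xf(x^k,y^k)+(\lambda^{k+1})^{T}\nabla_xg(x^k,y^k)-\nabla_xf(x^k,\theta^{k+1})-(z^k)^{T}\nabla_xg(x^k,\theta^{k+1})$; $d_y^k=\frac1{c_k}\nabla_yF(x^k,y^k)+\nabla_yf(x^k,y^k)+(\lambda^{k+1})^{T}\nabla_yg(x^k,y^k)-(y^k-\theta^{k+1})/\gamma_1$; $d_z^k=-(z^k-\lambda^{k+1})/\gamma_2-g(x^k,\theta^{k+1})$; $(x^{k+1},y^{k+1},z^{k+1})=\mathrm{Proj}_{X\times Y\times Z}\big((x^k,y^k,z^k)-\alpha_k(d_x^k,d_y^k,d_z^k)\big)$.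
   Formalization: Lipschitz continuity of ∇_x g and ∇_y g is measured in the norm sup{‖z^T A‖ : |z_i| ≤ 1} instead of the spectral norm (they agree for p=1); with the spectral norm the bound 1/(L_f + rL_{g2} + 1/γ_1) on η_k is too large for big p and the claim fails. *)

(* Defs.v *)
From HB Require Import structures.
From mathcomp Require Export all_boot all_order all_algebra.
From mathcomp Require Export all_classical all_reals all_analysis.
Export numFieldNormedType.Exports.

Set Implicit Arguments.
Unset Strict Implicit.
Unset Printing Implicit Defensive.

Import Order.TTheory GRing.Theory Num.Theory.

Local Open Scope classical_set_scope.
Local Open Scope ring_scope.

(* Vectors are rows; a point (x, y) of R^n x R^m is [row_mx x y] in R^(n + m),
   and (x, y, z) is [row_mx (row_mx x y) z]. The norm that MathComp-Analysis
   attaches to 'rV[R]_n is the sup norm, so the Euclidean one is defined here;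
   both induce the same topology and the same differentials. *)

Definition dotp (R : realType) (n : nat) (u v : 'rV[R]_n) : R :=
  \sum_(i < n) u 0 i * v 0 i.

Definition enorm (R : realType) (n : nat) (u : 'rV[R]_n) : R :=
  Num.sqrt (dotp u u).

(* distance from a point to a (nonempty) set *)
Definition edist (R : realType) (n : nat) (u : 'rV[R]_n) (S : set 'rV[R]_n) : R :=
  inf [set enorm (u - s) | s in S].

Definition setXrow (R : realType) (n m : nat) (A : set 'rV[R]_n) (B : set 'rV[R]_m) :
    set 'rV[R]_(n + m) :=
  [set u | A (lsubmx u) /\ B (rsubmx u)].

Definition orthant (R : realType) (p : nat) : set 'rV[R]_p :=
  [set l | forall i, 0 <= l 0 i].

Definition box (R : realType) (p : nat) (r : R) : set 'rV[R]_p :=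
  [set z | forall i, 0 <= z 0 i <= r].

Definition is_proj (R : realType) (n : nat) (C : set 'rV[R]_n) (u v : 'rV[R]_n) :
    Prop :=
  C v /\ forall w, C w -> enorm (u - v) <= enorm (u - w).

Definition normal_cone (R : realType) (n : nat) (C : set 'rV[R]_n) (u : 'rV[R]_n) :
    set 'rV[R]_n :=
  [set v | C u /\ forall w, C w -> dotp v (w - u) <= 0].

Definition grad (R : realType) (n : nat) (h : 'rV[R]_n -> R) (u : 'rV[R]_n) :
    'rV[R]_n :=
  \row_(i < n) 'D_(delta_mx 0 i) (h : 'rV[R]_n -> R^o) u.

Definition gradx (R : realType) (n m : nat) (h : 'rV[R]_(n + m) -> R)
    (x : 'rV[R]_n) (y : 'rV[R]_m) : 'rV[R]_n :=
  grad (fun x' => h (row_mx x' y)) x.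

Definition grady (R : realType) (n m : nat) (h : 'rV[R]_(n + m) -> R)
    (x : 'rV[R]_n) (y : 'rV[R]_m) : 'rV[R]_m :=
  grad (fun y' => h (row_mx x y')) y.

(* The library Jacobian acts on rows from the right: entry (i, j) is the
   derivative of the j-th component along the i-th coordinate. Hence the row
   z^T (\nabla_x g) of the mathematics is [z *m (jacx g x y)^T]. *)
Definition jacx (R : realType) (n m p : nat) (g : 'rV[R]_(n + m) -> 'rV[R]_p)
    (x : 'rV[R]_n) (y : 'rV[R]_m) : 'M[R]_(n, p) :=
  jacobian (fun x' => g (row_mx x' y)) x.

Definition jacy (R : realType) (n m p : nat) (g : 'rV[R]_(n + m) -> 'rV[R]_p)
    (x : 'rV[R]_n) (y : 'rV[R]_m) : 'M[R]_(m, p) :=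
  jacobian (fun y' => g (row_mx x y')) y.

(* Induced norm of a Jacobian as the linear map z |-> z^T (\nabla g) from R^p
   with the sup norm ([`|z|]) to R^q with the Euclidean norm; equivalently, the
   norm of h |-> (\nabla g) h from l^2 to l^1. Multipliers live in the box
   [0, r]^p, and this is the norm for which z^T g(x, .) has an r L-Lipschitz
   gradient whenever \nabla_y g is L-Lipschitz, with no dimensional factor
   (for the spectral norm the factor is r sqrt p). If p = 1 it is the
   Euclidean norm of the gradient. *)
Definition jac_norm (R : realType) (q p : nat) (A : 'M[R]_(q, p)) : R :=
  sup [set enorm (z *m A^T) | z in [set z : 'rV[R]_p | `|z| <= 1]].

(* h is L-Lipschitz on S, N being the norm on the codomain *)
Definition lipschitz_norm (R : realType) (n : nat) (V : zmodType) (N : V -> R)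
    (L : R) (S : set 'rV[R]_n) (h : 'rV[R]_n -> V) : Prop :=
  0 <= L /\ forall u v, S u -> S v -> N (h u - h v) <= L * enorm (u - v).

Definition smooth_on (R : realType) (n : nat) (L : R) (S : set 'rV[R]_n)
    (h : 'rV[R]_n -> R) : Prop :=
  lipschitz_norm (@enorm R n) L S (grad h).

(* Continuous differentiability on a set that need not be open: h is the
   restriction of a function differentiable at every point of S, whose gradient
   is continuous relatively to S. *)
Definition cont_diff_on (R : realType) (n : nat) (S : set 'rV[R]_n)
    (h : 'rV[R]_n -> R) : Prop :=
  (forall u, S u -> differentiable (h : 'rV[R]_n -> R^o) u) /\
  {within S, continuous (grad h)}.

Definition upper_assumption (R : realType) (n m : nat)
    (X : set 'rV[R]_n) (Y : set 'rV[R]_m) (F : 'rV[R]_(n + m) -> R) (LF : R) :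
    Prop :=
  [/\ cont_diff_on (setXrow X Y) F,
      smooth_on LF (setXrow X Y) F &
      has_lbound (F @` setXrow X Y)].

Definition lower_objective_assumption (R : realType) (n m : nat)
    (X : set 'rV[R]_n) (Y : set 'rV[R]_m) (f : 'rV[R]_(n + m) -> R) (Lf : R) :
    Prop :=
  [/\ forall x, X x -> convex_function Y (fun y => f (row_mx x y)),
      exists O : set 'rV[R]_(n + m),
        [/\ open O, setXrow X Y `<=` O &
            forall u, O u -> differentiable (f : _ -> R^o) u /\
                             {for u, continuous (grad f)}] &
      smooth_on Lf (setXrow X Y) f].

Definition constraint_assumption (R : realType) (n m p : nat)
    (X : set 'rV[R]_n) (Y : set 'rV[R]_m) (g : 'rV[R]_(n + m) -> 'rV[R]_p)
    (Lg Lg1 Lg2 : R) : Prop :=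
  [/\ forall x, X x -> forall i, convex_function Y (fun y => g (row_mx x y) 0 i),
      lipschitz_norm (@enorm R p) Lg (setXrow X Y) g,
      exists O : set 'rV[R]_(n + m),
        [/\ open O, setXrow X Y `<=` O &
            forall u, O u -> differentiable g u /\
                             {for u, continuous (jacobian g)}],
      lipschitz_norm (@jac_norm R n p) Lg1 (setXrow X Y)
        (fun u => jacx g (lsubmx u) (rsubmx u)) &
      lipschitz_norm (@jac_norm R m p) Lg2 (setXrow X Y)
        (fun u => jacy g (lsubmx u) (rsubmx u))].

Definition lagrangian (R : realType) (n m p : nat) (f : 'rV[R]_(n + m) -> R)
    (g : 'rV[R]_(n + m) -> 'rV[R]_p) (x : 'rV[R]_n) (y : 'rV[R]_m) (z : 'rV[R]_p) :
    R :=
  f (row_mx x y) + dotp z (g (row_mx x y)).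

(* [sup] of a set of reals is only meaningful when the set is bounded above;
   here the maximum is attained as soon as Y is compact and nonempty and
   f(x, .), g(x, .) are continuous on Y. *)
Definition gap (R : realType) (n m p : nat) (Y : set 'rV[R]_m)
    (f : 'rV[R]_(n + m) -> R) (g : 'rV[R]_(n + m) -> 'rV[R]_p) (gamma1 gamma2 : R)
    (x : 'rV[R]_n) (y : 'rV[R]_m) (z : 'rV[R]_p) : R :=
  sup [set lagrangian f g x y tl.2 - (2 * gamma2)^-1 * enorm (tl.2 - z) ^+ 2
           - lagrangian f g x tl.1 z - (2 * gamma1)^-1 * enorm (tl.1 - y) ^+ 2
      | tl in Y `*` @orthant R p].

Definition psi (R : realType) (n m p : nat) (Y : set 'rV[R]_m)
    (F f : 'rV[R]_(n + m) -> R) (g : 'rV[R]_(n + m) -> 'rV[R]_p)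
    (gamma1 gamma2 c : R) (w : 'rV[R]_(n + m + p)) : R :=
  F (lsubmx w) +
  c * gap Y f g gamma1 gamma2 (lsubmx (lsubmx w)) (rsubmx (lsubmx w)) (rsubmx w).

Definition residual (R : realType) (n m p : nat)
    (X : set 'rV[R]_n) (Y : set 'rV[R]_m) (r : R)
    (F f : 'rV[R]_(n + m) -> R) (g : 'rV[R]_(n + m) -> 'rV[R]_p)
    (gamma1 gamma2 c : R) (x : 'rV[R]_n) (y : 'rV[R]_m) (z : 'rV[R]_p) : R :=
  let w := row_mx (row_mx x y) z in
  edist 0 [set grad (psi Y F f g gamma1 gamma2 c) w + v
          | v in normal_cone (setXrow (setXrow X Y) (@box R p r)) w].

Definition dir_theta (R : realType) (n m p : nat)
    (f : 'rV[R]_(n + m) -> R) (g : 'rV[R]_(n + m) -> 'rV[R]_p) (gamma1 : R)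
    (x : 'rV[R]_n) (y : 'rV[R]_m) (z : 'rV[R]_p) (th : 'rV[R]_m) : 'rV[R]_m :=
  grady f x th + z *m (jacy g x th)^T + gamma1^-1 *: (th - y).

Definition dir_x (R : realType) (n m p : nat)
    (F f : 'rV[R]_(n + m) -> R) (g : 'rV[R]_(n + m) -> 'rV[R]_p) (c : R)
    (x : 'rV[R]_n) (y : 'rV[R]_m) (z : 'rV[R]_p) (th : 'rV[R]_m) (la : 'rV[R]_p) :
    'rV[R]_n :=
  c^-1 *: gradx F x y + gradx f x y + la *m (jacx g x y)^T
  - gradx f x th - z *m (jacx g x th)^T.

Definition dir_y (R : realType) (n m p : nat)
    (F f : 'rV[R]_(n + m) -> R) (g : 'rV[R]_(n + m) -> 'rV[R]_p) (gamma1 c : R)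
    (x : 'rV[R]_n) (y : 'rV[R]_m) (th : 'rV[R]_m) (la : 'rV[R]_p) : 'rV[R]_m :=
  c^-1 *: grady F x y + grady f x y + la *m (jacy g x y)^T
  - gamma1^-1 *: (y - th).

Definition dir_z (R : realType) (n m p : nat)
    (g : 'rV[R]_(n + m) -> 'rV[R]_p) (gamma2 : R)
    (x : 'rV[R]_n) (z : 'rV[R]_p) (th : 'rV[R]_m) (la : 'rV[R]_p) : 'rV[R]_p :=
  - (gamma2^-1 *: (z - la)) - g (row_mx x th).

(* The sequences are generated by the algorithm; [la 0] plays no role. *)
Definition BiC_GAFFA (R : realType) (n m p : nat)
    (X : set 'rV[R]_n) (Y : set 'rV[R]_m) (r : R)
    (F f : 'rV[R]_(n + m) -> R) (g : 'rV[R]_(n + m) -> 'rV[R]_p)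
    (gamma1 gamma2 : R) (c alpha eta : nat -> R)
    (x : nat -> 'rV[R]_n) (y : nat -> 'rV[R]_m) (z : nat -> 'rV[R]_p)
    (th : nat -> 'rV[R]_m) (la : nat -> 'rV[R]_p) : Prop :=
  [/\ [/\ X (x 0%N), Y (y 0%N), box r (z 0%N) & Y (th 0%N)],
      forall k, is_proj Y
        (th k - eta k *: dir_theta f g gamma1 (x k) (y k) (z k) (th k)) (th k.+1),
      forall k, is_proj (@orthant R p)
        (z k + gamma2 *: g (row_mx (x k) (y k))) (la k.+1) &
      forall k,
        let dx := dir_x F f g (c k) (x k) (y k) (z k) (th k.+1) (la k.+1) in
        let dy := dir_y F f g gamma1 (c k) (x k) (y k) (th k.+1) (la k.+1) in
        let dz := dir_z g gamma2 (x k) (z k) (th k.+1) (la k.+1) in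
        is_proj (setXrow (setXrow X Y) (@box R p r))
          (row_mx (row_mx (x k) (y k)) (z k) - alpha k *: row_mx (row_mx dx dy) dz)
          (row_mx (row_mx (x k.+1) (y k.+1)) (z k.+1))].

(* Main.v *)
Require Import Defs.
From mathcomp Require Import ring lra.

Set Implicit Arguments.
Unset Strict Implicit.
Unset Printing Implicit Defensive.

Import Order.TTheory GRing.Theory Num.Theory.

Local Open Scope classical_set_scope.
Local Open Scope ring_scope.

(** The gap function splits as A - V: the maximum A over the multiplier is explicit,
    attained at the projection of z + gamma2 g(x, y), and V is the minimal value over
    theta in Y of a strongly convex proximal objective. Danskin's theorem differentiates
    V, so that on X x Y x Z the gradient of psi_c is c times the direction of the
    algorithm, computed with the exact minimizer theta*(x, y, z) instead of theta^(k+1);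
    that minimizer, and hence this gradient, is Lipschitz.

    The inner projected gradient step contracts the distance to theta* by a factor that
    depends only on the lower bound of the step sizes eta_k. With e_k the distance from
    theta^k to theta*(w^k) and w^k = (x^k, y^k, z^k), the function psi_c(w^k) + M e_k^2
    therefore decreases by at least |w^(k+1) - w^k|^2 + e_k^2 at each step once the
    alpha_k are small, for a suitable M. The residual at w^(k+1) is bounded by a multiple
    of |w^(k+1) - w^k| + e_k, hence is square summable, and the smallest of K + 1 terms
    of a square summable sequence is O(K^(-1/2)). *)

(** * Euclidean geometry of row vectors *)

Section Euclidean.
Context {R : realType}.
Implicit Types (n m p : nat).

Lemma dotpC n (u v : 'rV[R]_n) : dotp u v = dotp v u.
Proof. by apply: eq_bigr => i _; rewrite mulrC. Qed.

Lemma dotpDl n (u v w : 'rV[R]_n) : dotp (u + v) w = dotp u w + dotp v w.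
Proof. by rewrite -big_split; apply: eq_bigr => i _; rewrite mxE mulrDl. Qed.

Lemma dotpZl n a (u v : 'rV[R]_n) : dotp (a *: u) v = a * dotp u v.
Proof. by rewrite [RHS]mulr_sumr; apply: eq_bigr => i _; rewrite mxE mulrA. Qed.

Lemma dotpNl n (u v : 'rV[R]_n) : dotp (- u) v = - dotp u v.
Proof. by rewrite -scaleN1r dotpZl mulN1r. Qed.

Lemma dotpBl n (u v w : 'rV[R]_n) : dotp (u - v) w = dotp u w - dotp v w.
Proof. by rewrite dotpDl dotpNl. Qed.

Lemma dotpDr n (u v w : 'rV[R]_n) : dotp w (u + v) = dotp w u + dotp w v.
Proof. by rewrite dotpC dotpDl !(dotpC w). Qed.

Lemma dotpZr n a (u v : 'rV[R]_n) : dotp u (a *: v) = a * dotp u v.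
Proof. by rewrite dotpC dotpZl dotpC. Qed.

Lemma dotpNr n (u v : 'rV[R]_n) : dotp u (- v) = - dotp u v.
Proof. by rewrite dotpC dotpNl dotpC. Qed.

Lemma dotpBr n (u v w : 'rV[R]_n) : dotp w (u - v) = dotp w u - dotp w v.
Proof. by rewrite dotpDr dotpNr. Qed.

Lemma dotp0l n (v : 'rV[R]_n) : dotp 0 v = 0.
Proof. by rewrite -(scale0r 0) dotpZl mul0r. Qed.

Lemma dotp_row_mx n m (a c : 'rV[R]_n) (b d : 'rV[R]_m) :
  dotp (row_mx a b) (row_mx c d) = dotp a c + dotp b d.
Proof.
rewrite /dotp big_split_ord; congr (_ + _); apply: eq_bigr => i _.
  by rewrite !row_mxEl.
by rewrite !row_mxEr.
Qed.

Lemma dotp_mulmx n m (z : 'rV[R]_m) (v : 'rV[R]_n) (A : 'M[R]_(n, m)) :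
  dotp z (v *m A) = dotp (z *m A^T) v.
Proof.
rewrite /dotp; under eq_bigr do rewrite mxE mulr_sumr.
rewrite exchange_big; apply: eq_bigr => j _; rewrite mxE mulr_suml.
by apply: eq_bigr => i _; rewrite mxE mulrA mulrAC.
Qed.

Lemma dotp_delta n (u : 'rV[R]_n) i : dotp u (delta_mx 0 i) = u 0 i.
Proof.
rewrite /dotp (bigD1 i) //= mxE !eqxx mulr1 big1 ?addr0 // => j ji.
by rewrite mxE (negbTE ji) andbF mulr0.
Qed.

Lemma dotp_ge0 n (u : 'rV[R]_n) : 0 <= dotp u u.
Proof. by apply: sumr_ge0 => i _; rewrite -expr2 sqr_ge0. Qed.

Lemma sqr_enorm n (u : 'rV[R]_n) : enorm u ^+ 2 = dotp u u.
Proof. by rewrite sqr_sqrtr ?dotp_ge0. Qed.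

Lemma enorm_ge0 n (u : 'rV[R]_n) : 0 <= enorm u.
Proof. exact: sqrtr_ge0. Qed.

Lemma enorm0 n : enorm (0 : 'rV[R]_n) = 0.
Proof. by rewrite /enorm dotp0l sqrtr0. Qed.

Lemma enorm_eq0 n (u : 'rV[R]_n) : enorm u <= 0 -> u = 0.
Proof.
move=> u0; have : dotp u u = 0.
  by rewrite -sqr_enorm (_ : enorm u = 0) ?expr0n //; apply/le_anti; rewrite u0 enorm_ge0.
move=> /eqP; rewrite psumr_eq0 => [|i _]; last by rewrite -expr2 sqr_ge0.
move=> /allP u_0; apply/rowP => i; rewrite mxE; apply/eqP.
by have := u_0 i (mem_index_enum i); rewrite mulf_eq0 orbb.
Qed.

Lemma enormZ n a (u : 'rV[R]_n) : enorm (a *: u) = `|a| * enorm u.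
Proof.
by rewrite /enorm dotpZl dotpZr mulrA -expr2 sqrtrM ?sqr_ge0 // sqrtr_sqr.
Qed.

Lemma enormN n (u : 'rV[R]_n) : enorm (- u) = enorm u.
Proof. by rewrite -scaleN1r enormZ normrN1 mul1r. Qed.

Lemma enormBC n (u v : 'rV[R]_n) : enorm (u - v) = enorm (v - u).
Proof. by rewrite -enormN opprB. Qed.

(** The squared norm of [enorm v *: u - enorm u *: v] expands to twice [(enorm u * enorm v) * (enorm
    u * enorm v - dotp u v)]; the zero vectors are split off so that the first factor can be
    cancelled. *)
Lemma cauchy_schwarz n (u v : 'rV[R]_n) : dotp u v <= enorm u * enorm v.
Proof.
have [v0|v0] := leP (enorm v) 0.
  by rewrite (enorm_eq0 v0) dotpC dotp0l enorm0 mulr0.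
have [u0|u0] := leP (enorm u) 0.
  by rewrite (enorm_eq0 u0) dotp0l enorm0 mul0r.
have := dotp_ge0 (enorm v *: u - enorm u *: v).
rewrite !dotpBl !dotpBr !dotpZl !dotpZr (dotpC v u) -!sqr_enorm => h.
have {h} : 0 <= (enorm u * enorm v) * (enorm u * enorm v - dotp u v) by nra.
by rewrite pmulr_rge0 ?mulr_gt0 // subr_ge0.
Qed.

Lemma ler_enormD n (u v : 'rV[R]_n) : enorm (u + v) <= enorm u + enorm v.
Proof.
rewrite -(@ler_pXn2r _ 2) ?nnegrE ?addr_ge0 ?enorm_ge0 //.
rewrite sqrrD !sqr_enorm dotpDl !dotpDr (dotpC v u).
have := cauchy_schwarz u v; lra.
Qed.

Lemma ler_enormB n (u v : 'rV[R]_n) : enorm (u - v) <= enorm u + enorm v.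
Proof. by rewrite -(enormN v) ler_enormD. Qed.

Lemma ler_enorm_distD n (w u v : 'rV[R]_n) :
  enorm (u - v) <= enorm (u - w) + enorm (w - v).
Proof. by rewrite (le_trans _ (ler_enormD _ _)) // addrA subrK. Qed.

Lemma sqr_enorm_row_mx n m (a : 'rV[R]_n) (b : 'rV[R]_m) :
  enorm (row_mx a b) ^+ 2 = enorm a ^+ 2 + enorm b ^+ 2.
Proof. by rewrite !sqr_enorm dotp_row_mx. Qed.

Lemma enorm_row_mx0 n m (a : 'rV[R]_n) : enorm (row_mx a (0 : 'rV_m)) = enorm a.
Proof. by rewrite /enorm dotp_row_mx dotp0l addr0. Qed.

Lemma enorm_row_0mx n m (b : 'rV[R]_m) : enorm (row_mx (0 : 'rV_n) b) = enorm b.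
Proof. by rewrite /enorm dotp_row_mx dotp0l add0r. Qed.

Lemma enorm_row_mx_le n m (a : 'rV[R]_n) (b : 'rV[R]_m) :
  enorm (row_mx a b) <= enorm a + enorm b.
Proof.
rewrite -(enorm_row_mx0 m a) -(enorm_row_0mx n b) (le_trans _ (ler_enormD _ _)) //.
by rewrite add_row_mx addr0 add0r.
Qed.

Lemma enorm_lsubmx n m (u : 'rV[R]_(n + m)) : enorm (lsubmx u) <= enorm u.
Proof.
rewrite -(@ler_pXn2r _ 2) ?nnegrE ?enorm_ge0 //.
by have := sqr_enorm_row_mx (lsubmx u) (rsubmx u); rewrite hsubmxK => ->; rewrite lerDl sqr_ge0.
Qed.

Lemma enorm_rsubmx n m (u : 'rV[R]_(n + m)) : enorm (rsubmx u) <= enorm u.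
Proof.
rewrite -(@ler_pXn2r _ 2) ?nnegrE ?enorm_ge0 //.
by have := sqr_enorm_row_mx (lsubmx u) (rsubmx u); rewrite hsubmxK => ->; rewrite lerDr sqr_ge0.
Qed.

Lemma mxnorm_le_enorm n (u : 'rV[R]_n) : `|u| <= enorm u.
Proof.
rewrite [leLHS]/Num.Def.normr /= mx_normrE; apply: bigmax_le => [|[i j] _ /=].
  exact: enorm_ge0.
rewrite (ord1 i) -sqrtr_sqr ler_sqrt ?dotp_ge0 // /dotp (bigD1 j) //= -expr2.
by rewrite lerDl sumr_ge0 // => k _; rewrite -expr2 sqr_ge0.
Qed.

Lemma coord_le_mxnorm n (u : 'rV[R]_n) i : `|u 0 i| <= `|u|.
Proof.
rewrite [leRHS]/Num.Def.normr /= mx_normrE.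
exact: (le_bigmax _ (fun ij : 'I_1 * 'I_n => `|u ij.1 ij.2|) (0, i)).
Qed.

Lemma enorm_le_mxnorm n (u : 'rV[R]_n) : enorm u <= Num.sqrt n%:R * `|u|.
Proof.
rewrite -(@ler_pXn2r _ 2) ?nnegrE ?mulr_ge0 ?enorm_ge0 ?sqrtr_ge0 //.
rewrite exprMn (sqr_sqrtr (ler0n _ n)) sqr_enorm /dotp.
apply: (@le_trans _ _ (\sum_(i < n) `|u| ^+ 2)); last first.
  by rewrite sumr_const card_ord mulr_natl.
apply: ler_sum => i _; rewrite -expr2 -real_normK ?num_real //.
by rewrite ler_pXn2r ?nnegrE // coord_le_mxnorm.
Qed.

Lemma compact_enorm_bounded n (A : set 'rV[R]_n) : compact A ->
  exists2 M, 0 <= M & forall u, A u -> enorm u <= M.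
Proof.
move=> /compact_bounded[M [_ /(_ (`|M| + 1))]]; rewrite (le_lt_trans (ler_norm M)) ?ltrDl //.
move=> /(_ isT) AM; exists (Num.sqrt n%:R * (`|M| + 1)).
  by rewrite mulr_ge0 ?sqrtr_ge0 ?addr_ge0.
move=> u /AM uM; rewrite (le_trans (enorm_le_mxnorm u)) // ler_wpM2l ?sqrtr_ge0 //.
Qed.

(** The convex combination is put in the shape [t *: (v - u) + u], the one in which derivatives
    along lines unfold. *)
Lemma convex_setP n (A : set 'rV[R]_n) (u v : 'rV[R]_n) (t : R) :
  convex_set A -> A u -> A v -> 0 <= t <= 1 -> A (t *: (v - u) + u).
Proof.
move=> cA Au Av /andP[t0 t1].
have := cA v u (Itv01 t0 t1); rewrite !inE => /(_ Av Au).
suff -> : conv (Itv01 t0 t1) (v : convex_lmodType _) u = t *: (v - u) + u by [].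
by rewrite /conv /= /unstable.onem scalerBl scale1r scalerBr addrA addrAC.
Qed.

Lemma convex_functionP n (A : set 'rV[R]_n) (h : 'rV[R]_n -> R) (u v : 'rV[R]_n) (t : R) :
  convex_function A h -> A u -> A v -> 0 <= t <= 1 ->
  h (t *: (v - u) + u) <= h u + t * (h v - h u).
Proof.
move=> ch Au Av /andP[t0 t1].
have := ch (Itv01 t0 t1) v u; rewrite !inE => /(_ Av Au).
suff -> : conv (Itv01 t0 t1) (v : convex_lmodType _) u = t *: (v - u) + u.
  move=> /le_trans; apply.
  rewrite /conv /= /conv /= /unstable.onem /GRing.scale /=; lra.
by rewrite /conv /= /unstable.onem scalerBl scale1r scalerBr addrA addrAC.
Qed.

Lemma convex_setXrow n m (A : set 'rV[R]_n) (B : set 'rV[R]_m) :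
  convex_set A -> convex_set B -> convex_set (setXrow A B).
Proof.
move=> cA cB u v l; rewrite !inE => -[Au Bu] [Av Bv].
have := cA (lsubmx u) (lsubmx v) l; rewrite !inE => /(_ Au Av) Al.
have := cB (rsubmx u) (rsubmx v) l; rewrite !inE => /(_ Bu Bv) Bl.
by split; rewrite /conv /= linearD !linearZ.
Qed.

Lemma convex_box p r : convex_set (@box R p r).
Proof.
move=> u v l; rewrite !inE => Au Av i.
rewrite /conv /= !mxE /unstable.onem.
have := Au i; have := Av i; have : 0 <= l%:num by []. have : l%:num <= 1 by [].
move: l%:num (u 0 i) (v 0 i) => /= t a b; nra.
Qed.

Lemma convex_orthant p : convex_set (@orthant R p).
Proof.
move=> u v l; rewrite !inE => Au Av i.
rewrite /conv /= !mxE /unstable.onem.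
have := Au i; have := Av i; have : 0 <= l%:num by []. have : l%:num <= 1 by [].
move: l%:num (u 0 i) (v 0 i) => /= t a b; nra.
Qed.

(** Moving from [v] towards [w] stays in [C] and cannot bring the point closer to [u]; to first
    order this is the claimed sign. *)
Lemma is_proj_vi n (C : set 'rV[R]_n) (u v w : 'rV[R]_n) :
  convex_set C -> is_proj C u v -> C w -> dotp (u - v) (w - v) <= 0.
Proof.
move=> cC [Cv vmin] Cw; rewrite leNgt; apply/negP => d0.
set d := dotp _ _ in d0; set q := dotp (w - v) (w - v).
have q0 : 0 <= q by exact: dotp_ge0.
have main t : 0 <= t <= 1 -> 2 * t * d <= t ^+ 2 * q.
  move=> t01; have := vmin _ (convex_setP cC Cv Cw t01).
  rewrite /enorm ler_sqrt ?dotp_ge0 //.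
  have -> : u - (t *: (w - v) + v) = (u - v) - t *: (w - v).
    by rewrite opprD addrCA addrC.
  rewrite /d /q; move: (u - v) (w - v) => a b.
  rewrite dotpBl !dotpBr !dotpZl !dotpZr (dotpC b); nra.
have [qd|dq] := leP q d; first by have := main 1; rewrite ler01 lexx => /(_ isT); lra.
have q1 : 0 < q by lra.
have := main (d / q); rewrite divr_ge0 ?(ltW d0) //= ler_pdivrMr // mul1r (ltW dq).
move=> /(_ isT); have -> : (d / q) ^+ 2 * q = d * (d / q) by field; lra.
have : 0 < d * (d / q) by rewrite !mulr_gt0 // invr_gt0.
lra.
Qed.

End Euclidean.

(** * Matrices acting on multipliers, and projection onto the nonnegative orthant *)

Section Multipliers.
Context {R : realType}.

(** This makes the set under the supremum in [jac_norm] bounded, so that the supremum is an actual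
    upper bound. *)
Lemma enorm_mulmx_bound q p (A : 'M[R]_(q, p)) :
  exists2 B, 0 <= B & forall z : 'rV[R]_p, enorm (z *m A^T) <= B * `|z|.
Proof.
exists (\sum_(i < p) enorm (row i A^T)) => [|z].
  by apply: sumr_ge0 => i _; exact: enorm_ge0.
rewrite mulmx_sum_row mulr_suml.
elim/big_ind2: _ => [|a b c d ab cd|i _]; first by rewrite enorm0.
  by rewrite (le_trans (ler_enormD _ _)) ?lerD.
by rewrite enormZ mulrC ler_wpM2l ?enorm_ge0 ?coord_le_mxnorm.
Qed.

Lemma enorm_mulmx_jac q p (A : 'M[R]_(q, p)) (z : 'rV[R]_p) :
  enorm (z *m A^T) <= jac_norm A * `|z|.
Proof.
have [->|z0] := eqVneq z 0; first by rewrite mul0mx enorm0 normr0 mulr0.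
have zn : 0 < `|z| by rewrite normr_gt0.
rewrite -ler_pdivrMr // mulrC -[X in X * _](ger0_norm (_ : 0 <= `|z|^-1)) ?invr_ge0 //.
rewrite -enormZ scalemxAl; apply: ub_le_sup.
  have [B B0 HB] := enorm_mulmx_bound A; exists B => _ [y /= y1 <-].
  by rewrite (le_trans (HB y)) // ler_piMr.
by exists (`|z|^-1 *: z) => //=; rewrite normrZ gtr0_norm ?invr_gt0 // mulVf ?gt_eqF.
Qed.

(** The Euclidean projection onto the orthant, given by a formula so that its squared norm can be
    differentiated. *)
Definition pospart p (u : 'rV[R]_p) : 'rV[R]_p := \row_i Num.max 0 (u 0 i).

Lemma orthant_pospart p (u : 'rV[R]_p) : orthant (pospart u).
Proof. by move=> i; rewrite mxE le_max lexx. Qed.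

Lemma pospart_vi p (u w : 'rV[R]_p) :
  orthant w -> dotp (u - pospart u) (w - pospart u) <= 0.
Proof.
move=> w0; rewrite /dotp; apply: sumr_le0 => i _; rewrite !mxE.
have wi : 0 <= w 0 i := w0 i; case: (leP 0 (u 0 i)) => h; first by rewrite subrr mul0r.
by rewrite !subr0 nmulr_rle0.
Qed.

(** Moreau decomposition: positive and negative parts have disjoint supports. It eliminates the
    squared norm of the multiplier when the gap is maximized. *)
Lemma dotp_pospart p (u : 'rV[R]_p) : dotp (u - pospart u) (pospart u) = 0.
Proof.
apply: big1 => i _; rewrite !mxE.
by case: (leP 0 (u 0 i)) => h; rewrite ?subrr ?mul0r ?mulr0.
Qed.

Lemma pospart_lip p (u v : 'rV[R]_p) :
  enorm (pospart u - pospart v) <= enorm (u - v).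
Proof.
rewrite /enorm ler_sqrt ?dotp_ge0 //; apply: ler_sum => i _; rewrite !mxE.
have [u0|u0] := leP 0 (u 0 i); have [v0|v0] := leP 0 (v 0 i) => //.
- have : 0 <= u 0 i * - v 0 i by rewrite mulr_ge0 // oppr_ge0 ltW.
  by have := sqr_ge0 (v 0 i); lra.
- have : 0 <= - u 0 i * v 0 i by rewrite mulr_ge0 // oppr_ge0 ltW.
  by have := sqr_ge0 (u 0 i); lra.
- by rewrite subrr mulr0 -expr2 sqr_ge0.
Qed.

(** The variational inequalities of two projections, each tested with the other point, add up to a
    nonpositive squared distance. This identifies lambda^(k+1) with the explicit multiplier. *)
Lemma is_proj_orthant p (u v : 'rV[R]_p) : is_proj (@orthant R p) u v -> v = pospart u.
Proof.
move=> Puv; have [v0 _] := Puv.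
have h1 := is_proj_vi (@convex_orthant R p) Puv (orthant_pospart u).
have h2 := pospart_vi u v0.
apply/eqP; rewrite -subr_eq0; apply/eqP/enorm_eq0.
rewrite -(@ler_pXn2r _ 2) ?nnegrE ?enorm_ge0 // expr0n /= sqr_enorm.
have -> : dotp (v - pospart u) (v - pospart u) =
  dotp (u - pospart u) (v - pospart u) + dotp (u - v) (pospart u - v).
  rewrite {1}(_ : v - pospart u = (u - pospart u) - (u - v)).
    by rewrite dotpBl -dotpNr opprB.
  by rewrite opprB [RHS]addrC addrA subrK.
lra.
Qed.

End Multipliers.

(** * Calculus along lines *)

Section Lines.
Context {R : realType}.

(** Both difference quotients are the same function of the increment. One-variable rules thereby
    apply to directional derivatives. *)
Lemma is_derive_line (V W : normedModType R) (h : V -> W) (a v : V) (d : W) (t : R) :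
  is_derive (t *: v + a) v h d -> is_derive t 1 (fun s : R => h (s *: v + a)) d.
Proof.
move=> [hc hd]; have E : (fun k : R => k^-1 *: (((fun s : R => h (s *: v + a)) \o shift t) (k *: 1) - h (t *: v + a)))
   = (fun k : R => k^-1 *: ((h \o shift (t *: v + a)) (k *: v) - h (t *: v + a))).
  by apply/funext => k /=; rewrite [k *: 1]mulr1 scalerDl addrA.
by split; [rewrite /derivable E | rewrite /derive E].
Qed.

Lemma is_derive_of_line (V W : normedModType R) (h : V -> W) (a v : V) (d : W) :
  is_derive (0 : R) 1 (fun s : R => h (s *: v + a)) d -> is_derive a v h d.
Proof.
have E : (fun k : R => k^-1 *: (((fun s : R => h (s *: v + a)) \o shift 0) (k *: 1) - h (0 *: v + a)))
   = (fun k : R => k^-1 *: ((h \o shift a) (k *: v) - h a)).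
  by apply/funext => k /=; rewrite [k *: 1]mulr1 addr0 scale0r add0r.
by move=> [hc hd]; move: hc hd; rewrite /derivable /derive E.
Qed.

(** The first-order expansion avoids division and holds on full neighbourhoods of 0; in this form a
    derivative can be obtained by squeezing. *)
Lemma is_derive_lineP (h : R -> R) (t d : R) :
  (forall e, 0 < e -> \forall s \near 0, `|h (s + t) - h t - s * d| <= e * `|s|) ->
  is_derive t 1 h d.
Proof.
move=> H; have C : (k^-1 *: ((h \o shift t) (k *: 1) - h t) : R^o) @[k --> 0^'] --> (d : R^o).
  apply/cvgrPdist_le => e e0; near=> k.
  have k0 : k != 0 by near: k; exact: nbhs_dnbhs_neq.
  rewrite /= [k *: 1]mulr1 distrC /GRing.scale /=.
  have -> : k^-1 * (h (k + t) - h t) - d = k^-1 * (h (k + t) - h t - k * d).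
    by rewrite [RHS]mulrBr mulKf.
  rewrite normrM normfV mulrC ler_pdivrMr ?normr_gt0 //.
  near: k; apply: nbhs_dnbhs; exact: H.
by split; [apply/cvg_ex; exists d | apply/cvg_lim].
Unshelve. all: by end_near. Qed.

Lemma is_derive_lineE (h : R -> R) (t d : R) : is_derive t 1 (h : R -> R^o) d ->
  forall e, 0 < e -> \forall s \near 0, `|h (s + t) - h t - s * d| <= e * `|s|.
Proof.
move=> [hc hd] e e0.
have C : (k^-1 *: ((h \o shift t) (k *: 1) - h t) : R^o) @[k --> 0^'] --> (d : R^o).
  by rewrite -hd; exact: hc.
move/cvgrPdist_le : C => /(_ e e0); rewrite near_withinE; apply: filterS => k.
have [->|k0 /(_ isT)] := eqVneq k 0.
  by move=> _; rewrite add0r subrr mul0r subrr !normr0 mulr0.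
rewrite /= [k *: 1]mulr1 distrC /GRing.scale /=.
have -> : k^-1 * (h (k + t) - h t) - d = k^-1 * (h (k + t) - h t - k * d).
  by rewrite [RHS]mulrBr mulKf.
by rewrite normrM normfV mulrC ler_pdivrMr ?normr_gt0.
Qed.

Lemma MVT01 (h dh : R -> R) :
  (forall t : R, 0 <= t <= 1 -> is_derive t 1 (h : R -> R^o) (dh t)) ->
  exists2 t : R, 0 <= t <= 1 & h 1 - h 0 = dh t.
Proof.
move=> H; have [||t t01 e] := @MVT_segment R h dh 0 1 ler01.
- by move=> t; rewrite in_itv /= => /andP[t0 t1]; apply: H; rewrite !ltW.
- apply: derivable_within_continuous => t; rewrite in_itv /= => t01.
  by have [] := H t t01.
by exists t; [rewrite in_itv in t01 | rewrite e subr0 mulr1].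
Qed.

End Lines.

(** * Descent lemma and gradient inequality on a convex set *)

Section Descent.
Context {R : realType} {n : nat}.
Variables (S : set 'rV[R]_n) (h : 'rV[R]_n -> R) (G : 'rV[R]_n -> 'rV[R]_n).
Hypothesis cS : convex_set S.
Hypothesis dh : forall u v, S u -> is_derive u v (h : _ -> R^o) (dotp (G u) v).

Let dline a b (t : R) : S a -> S b -> 0 <= t <= 1 ->
  is_derive t 1 (fun s : R => h (s *: (b - a) + a) : R^o)
    (dotp (G (t *: (b - a) + a)) (b - a)).
Proof.
move=> Sa Sb t01; apply: (@is_derive_line R _ _ (h : _ -> R^o)); apply: dh.
exact: convex_setP.
Qed.

Lemma descent_lemma L a b :
  (forall u v, S u -> S v -> enorm (G u - G v) <= L * enorm (u - v)) ->
  S a -> S b -> h b <= h a + dotp (G a) (b - a) + L / 2 * enorm (b - a) ^+ 2.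
Proof.
move=> GL Sa Sb; set v := b - a.
(* The linear and quadratic terms are subtracted so that the Lipschitz bound on [G] makes the
   derivative of [k] nonpositive on [0, 1]; the claim is [k 1 <= k 0]. *)
pose k t := h (t *: v + a) - t * dotp (G a) v - t ^+ 2 * (L / 2 * enorm v ^+ 2).
have [|t t01 e] := @MVT01 _ k (fun t => dotp (G (t *: v + a)) v - dotp (G a) v
   - t * (L * enorm v ^+ 2)).
  move=> t t01; have D := dline Sa Sb t01; rewrite -/v in D.
  by rewrite /k; apply: is_derive_eq; rewrite /GRing.scale /=; lra.
have : dotp (G (t *: v + a)) v - dotp (G a) v - t * (L * enorm v ^+ 2) <= 0.
  rewrite subr_le0 -dotpBl (le_trans (cauchy_schwarz _ _)) //.
  rewrite mulrA expr2 mulrA ler_wpM2r ?enorm_ge0 //.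
  rewrite (le_trans (GL _ _ (convex_setP cS Sa Sb t01) Sa)) // addrK enormZ.
  by case/andP: t01 => t0 _; rewrite ger0_norm //; lra.
rewrite -e /k scale1r scale0r add0r subrK; nra.
Qed.

Lemma convex_gradient_ineq a b : convex_function S h -> S a -> S b ->
  h a + dotp (G a) (b - a) <= h b.
Proof.
move=> ch Sa Sb; rewrite leNgt; apply/negP => lt.
have D0 := dline Sa Sb (t := 0); rewrite lexx ler01 in D0.
have := is_derive_lineE (D0 isT); rewrite scale0r add0r.
(* With half of the assumed violation as first-order error, the expansion of [h] at [a] lies above
   the chord to [b] for small t > 0, against convexity. *)
set d := dotp _ _ in lt *; move=> /(_ ((h a + d - h b) / 2)).
rewrite divr_gt0 ?subr_gt0 // => /(_ isT) [e /= e0 He].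
pose t := Num.min (e / 2) 1.
have t0 : 0 < t by rewrite lt_min ltr01 divr_gt0.
have t1 : t <= 1 by rewrite ge_min lexx orbT.
have te : t < e by rewrite gt_min (_ : e / 2 < e) //; lra.
have := He t; rewrite /ball_ /= sub0r normrN gtr0_norm // => /(_ te).
rewrite addr0 ler_norml => /andP[+ _].
have := convex_functionP ch Sa Sb (t := t); rewrite (ltW t0) t1 => /(_ isT).
move: (h (t *: _ + a)) lt => k; nra.
Qed.

End Descent.

(** * Strongly convex minimization *)

Section StronglyConvex.
Context {R : realType} {n : nat}.
Variables (S : set 'rV[R]_n) (L mu : R).
Hypotheses (cS : convex_set S) (L_ge0 : 0 <= L).

(** Strong convexity with modulus [mu] and smoothness with constant [L], encoded by the two
    quadratic bounds alone; [G] plays the part of the gradient without any differentiability being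
    mentioned. *)
Definition strongly_convex_smooth (h : 'rV[R]_n -> R) (G : 'rV[R]_n -> 'rV[R]_n) :=
  forall a b, S a -> S b ->
    h a + dotp (G a) (b - a) + mu / 2 * enorm (b - a) ^+ 2 <= h b /\
    h b <= h a + dotp (G a) (b - a) + L / 2 * enorm (b - a) ^+ 2.

Definition is_min (h : 'rV[R]_n -> R) s := S s /\ forall a, S a -> h s <= h a.

Lemma is_min_vi h G s a : strongly_convex_smooth h G -> is_min h s -> S a ->
  0 <= dotp (G s) (a - s).
Proof.
move=> hG [Ss smin] Sa; rewrite leNgt; apply/negP => d0.
set d := dotp _ _ in d0; set q := L / 2 * enorm (a - s) ^+ 2.
have q0 : 0 <= q by rewrite mulr_ge0 ?sqr_ge0 // divr_ge0.
have main t : 0 <= t <= 1 -> 0 <= t * d + t ^+ 2 * q.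
  move=> t01; have St := convex_setP cS Ss Sa t01.
  have := smin _ St; have [_] := hG _ _ Ss St.
  by rewrite addrK enormZ dotpZr exprMn real_normK ?num_real // -/d /q; nra.
have dq0 : 0 < q - d by lra.
(* This step length lies in [0, 1] for every [q >= 0], and at it [t * d + t ^+ 2 * q] equals
   [- t ^+ 2 * (- d)], which is negative. *)
have /main : 0 <= - d / (q - d) <= 1.
  by rewrite ler_pdivrMr // mul1r divr_ge0 /=; lra.
have -> : - d / (q - d) * d + (- d / (q - d)) ^+ 2 * q = - (- d / (q - d)) ^+ 2 * (- d).
  by field; lra.
have : 0 < (- d / (q - d)) ^+ 2 * - d by rewrite mulr_gt0 ?exprn_gt0 ?divr_gt0 ?oppr_gt0.
lra.
Qed.

Lemma is_min_growth h G s a : strongly_convex_smooth h G -> is_min h s -> S a ->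
  h s + mu / 2 * enorm (a - s) ^+ 2 <= h a.
Proof.
move=> hG hs Sa; have := is_min_vi hG hs Sa.
have [h1 _] := hG _ _ hs.1 Sa; lra.
Qed.

(** Four inequalities are added: growth of [h] away from [s] at [b], the upper quadratic bound from
    [a] to [b], the lower one from [a] to [s], and the projection inequality at [b] tested with [s].
    The condition [eta * L <= 1] absorbs the term in [b - a]. *)
Lemma projected_gradient_contraction h G eta s a b :
  strongly_convex_smooth h G -> is_min h s -> S a -> 0 < eta -> eta * L <= 1 ->
  is_proj S (a - eta *: G a) b ->
  (1 + eta * mu) * enorm (b - s) ^+ 2 <= (1 - eta * mu) * enorm (a - s) ^+ 2.
Proof.
move=> hG hs Sa eta0 etaL Pb; have [Sb _] := Pb.
have [_ A] := hG _ _ Sa Sb; have [B _] := hG _ _ Sa hs.1.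
have C := is_min_growth hG hs Sb.
have P := is_proj_vi cS Pb hs.1.
have E1 : dotp (a - eta *: G a - b) (s - b) =
   eta * (dotp (G a) (b - a) - dotp (G a) (s - a)) - dotp (a - b) (b - s).
  by rewrite !(dotpBr, dotpBl, dotpZl); ring.
have E2 : enorm (a - s) ^+ 2 = enorm (b - a) ^+ 2 + enorm (b - s) ^+ 2 + 2 * dotp (a - b) (b - s).
  by rewrite !sqr_enorm !(dotpBr, dotpBl) (dotpC a b) (dotpC a s) (dotpC s b); ring.
rewrite (enormBC s a) in B; rewrite E1 in P.
move: (enorm (b - a) ^+ 2) (sqr_ge0 (enorm (b - a))) A E2 => ba ba0 A E2.
have : eta * (mu / 2 * enorm (b - s) ^+ 2 + mu / 2 * enorm (a - s) ^+ 2) <=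
  eta * (dotp (G a) (b - a) - dotp (G a) (s - a) + L / 2 * ba).
  by rewrite ler_pM2l //; lra.
have : eta * L * ba <= ba by rewrite ler_piMl.
lra.
Qed.

(** Growth at [s1] and the lower bound of [h1] from [s2] give [mu * enorm (s1 - s2) ^+ 2 <= dotp (G1
    s2) (s2 - s1)]. Optimality of [s2] for [h2] allows subtracting [G2 s2], and Cauchy-Schwarz
    concludes. *)
Lemma is_min_stable h1 G1 h2 G2 s1 s2 :
  strongly_convex_smooth h1 G1 -> strongly_convex_smooth h2 G2 ->
  is_min h1 s1 -> is_min h2 s2 ->
  mu * enorm (s1 - s2) <= enorm (G1 s2 - G2 s2).
Proof.
move=> hG1 hG2 hs1 hs2.
have A := is_min_growth hG1 hs1 hs2.1; have [B _] := hG1 _ _ hs2.1 hs1.1.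
have V := is_min_vi hG2 hs2 hs1.1; rewrite (enormBC s2 s1) in A.
have [->|ne] := eqVneq s1 s2; first by rewrite subrr enorm0 mulr0 enorm_ge0.
have e0 : 0 < enorm (s1 - s2).
  by rewrite ltNge; apply/negP => /enorm_eq0/eqP; rewrite subr_eq0 (negbTE ne).
rewrite -(ler_pM2r e0).
have := cauchy_schwarz (G1 s2 - G2 s2) (s2 - s1).
rewrite (enormBC s2 s1) -(opprB s1 s2) dotpNr dotpBl; nra.
Qed.

End StronglyConvex.

(** * Danskin's theorem *)

Section Danskin.
Context {R : realType} {m : nat}.
Variables (K : set 'rV[R]_m) (H : R -> 'rV[R]_m -> R) (H' : R -> 'rV[R]_m -> R).
Variables (s : 'rV[R]_m) (V : R -> R).
Hypotheses (K_compact : compact K) (Ks : K s).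
Hypothesis s_min : forall a, K a -> a != s -> H 0 s < H 0 a.
Hypothesis H_cont : forall a, K a ->
  (fun q : R * 'rV[R]_m => H q.1 q.2) q @[q --> (0, a)] --> H 0 a.
Hypothesis H_der : \forall q \near (0, s),
  is_derive (q.1 : R) 1 (H^~ q.2 : R -> R^o) (H' q.1 q.2).
Hypothesis H'_cont :
  (fun q : R * 'rV[R]_m => H' q.1 q.2) q @[q --> (0, s)] --> H' 0 s.
(* [V t] is the infimum of [H t] on [K] as soon as [H t] is bounded below there. *)
Hypothesis V_inf : forall t l, (forall a, K a -> l <= H t a) -> l <= V t <= H t s.
Hypothesis V0 : V 0 = H 0 s.

Let near_fst (a : 'rV[R]_m) d : 0 < d ->
  \forall q \near ((0 : R), a), `|q.1| < d.
Proof.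
move=> d0; exists (ball (0 : R) d, setT) => /=.
  by split; [exact: nbhsx_ballx | exact: filterT].
by case=> t b /= [+ _]; rewrite /ball /= sub0r normrN.
Qed.

(* By compactness it suffices to argue near each point of [K]: away from [s] the strict
   inequality of [s_min] leaves room, and near [s] the mean value theorem in [t] applies. *)
Let lower e : 0 < e -> \forall t \near 0, forall a, K a ->
  H 0 s + t * H' 0 s - e * `|t| <= H t a.
Proof.
move=> e0.
suff near_lower a : K a -> \forall q \near (0, a), K q.2 ->
    H 0 s + q.1 * H' 0 s - e * `|q.1| <= H q.1 q.2.
  have /compact_near_coveringP/near_covering_withinP/(_ R (nbhs (0 : R))
    (fun t a => H 0 s + t * H' 0 s - e * `|t| <= H t a)) := K_compact.
  apply => a /near_lower[[U W] /= [U0 Wa] UW].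
  by exists (W, U) => //= -[b t] /= [Wb Ut]; exact: (UW (t, b)).
move=> Ka; have [->|as_] := eqVneq a s; last first.
  have lt := s_min Ka as_; pose d := (H 0 a - H 0 s) / 2.
  have d0 : 0 < d by rewrite divr_gt0 ?subr_gt0.
  have c0 : 0 < `|H' 0 s| + e by rewrite ltr_wpDl.
  near=> q => _.
  have h1 : `|H 0 a - H q.1 q.2| <= d.
    by near: q; move/cvgrPdist_le : (H_cont Ka) => /(_ d d0).
  have h2 : `|q.1| * (`|H' 0 s| + e) <= d.
    rewrite -ler_pdivlMr // ltW //; near: q; apply: near_fst; exact: divr_gt0.
  have h3 := ler_norm (q.1 * H' 0 s); rewrite normrM in h3.
  have h4 : 0 <= e * `|q.1| by rewrite mulr_ge0 // ltW.
  move: h1; rewrite ler_norml /d in h2 *; lra.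
have /(filterI H_der) : \forall q \near (0, s), `|H' 0 s - H' q.1 q.2| <= e.
  by move/cvgrPdist_le : H'_cont => /(_ e e0).
move=> -[[U W] /= [/nbhs_ballP[d /= d0 dU] Ws] UW].
exists (ball (0 : R) d, W) => /=; first by split => //; exact: nbhsx_ballx.
case=> t b /= [tb Wb] Kb.
have Hmin : H 0 s <= H 0 b.
  by have [->|bs] := eqVneq b s; last by rewrite ltW ?s_min.
have inU u : 0 <= u <= 1 -> U (u * t).
  move=> /andP[u0 u1]; apply: dU; move: tb.
  rewrite /ball /= !sub0r !normrN normrM (ger0_norm u0) => /(le_lt_trans _); apply.
  by rewrite ler_piMl.
(* Rescaling the parameter to [0, 1] treats both signs of [t] at once. *)
have [|u u01] := @MVT01 R (fun u => H (u * t) b) (fun u => H' (u * t) b * t).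
  move=> u u01; have [D _] := UW (u * t, b) (conj (inU u u01) Wb).
  apply: (@is_derive1_comp R (H^~ b) (fun u => u * t) u).
  by apply: is_derive_eq; rewrite /GRing.scale /= mulr0 add0r mulr1.
rewrite mul1r mul0r => E.
have [_ /=] := UW (u * t, b) (conj (inU u u01) Wb).
move=> le; have : `|(H' 0 s - H' (u * t) b) * t| <= e * `|t|.
  by rewrite normrM ler_wpM2r.
by rewrite ler_norml => /andP[_]; lra.
Unshelve. all: by end_near. Qed.

Lemma danskin : is_derive (0 : R) 1 (V : R -> R^o) (H' 0 s).
Proof.
apply: is_derive_lineP => e e0.
have D := @nbhs_singleton _ _ _ H_der.
near=> t; rewrite addr0 V0.
have /V_inf/andP[lo hi] : forall a, K a -> H 0 s + t * H' 0 s - e * `|t| <= H t a.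
  by near: t; exact: lower.
have : `|H (t + 0) s - H 0 s - t * H' 0 s| <= e * `|t|.
  by near: t; exact: is_derive_lineE.
by rewrite addr0 !ler_norml; lra.
Unshelve. all: by end_near. Qed.

End Danskin.

(** * Row-valued functions *)

Section RowCalculus.
Context {R : realType}.

Lemma cvg_rowP (T : Type) (F : set_system T) {FF : Filter F} p (a : T -> 'rV[R]_p) (l : 'rV[R]_p) :
  (forall i, (a t 0 i : R) @[t --> F] --> (l 0 i : R)) -> a t @[t --> F] --> l.
Proof.
move=> H; apply/cvgrPdist_le => /= e e0.
have : \forall t \near F, forall i, `|l 0 i - a t 0 i| <= e.
  by apply: filter_forall => i; move/cvgrPdist_le : (H i); exact.
apply: filterS => t He.
rewrite [leLHS]/Num.Def.normr /= mx_normrE; apply: bigmax_le => [|[i j] _ /=].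
  exact: ltW.
by rewrite (ord1 i) !mxE; exact: He.
Qed.

Lemma cvg_coord (T : Type) (F : set_system T) {FF : Filter F} q p (a : T -> 'M[R]_(q, p)) (l : 'M[R]_(q, p)) i j :
  a t @[t --> F] --> l -> (a t i j : R) @[t --> F] --> (l i j : R).
Proof. by move=> al; exact: (cvg_comp _ _ al (@coord_continuous R q p i j l)). Qed.

Lemma cvg_sumR (T : Type) (F : set_system T) {FF : Filter F} p (a : 'I_p -> T -> R) (l : 'I_p -> R) :
  (forall i, a i t @[t --> F] --> (l i : R)) ->
  (\sum_(i < p) a i t) @[t --> F] --> \sum_(i < p) l i.
Proof.
move=> H; elim: p a l H => [|p IH] a l H.
  by rewrite big_ord0; under eq_fun do rewrite big_ord0; exact: cvg_cst.
rewrite big_ord_recl; under eq_fun do rewrite big_ord_recl.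
by apply: cvgD; [exact: H | apply: IH => i; exact: H].
Qed.

Lemma cvg_dotp (T : Type) (F : set_system T) {FF : Filter F} p (a b : T -> 'rV[R]_p) (la lb : 'rV[R]_p) :
  a t @[t --> F] --> la -> b t @[t --> F] --> lb ->
  dotp (a t) (b t) @[t --> F] --> dotp la lb.
Proof. by move=> ha hb; apply: cvg_sumR => i; apply: cvgM; exact: cvg_coord. Qed.

Lemma cvg_mulmx (T : Type) (F : set_system T) {FF : Filter F} q p
  (v : 'rV[R]_q) (A : T -> 'M[R]_(q, p)) (lA : 'M[R]_(q, p)) :
  A t @[t --> F] --> lA -> v *m A t @[t --> F] --> v *m lA.
Proof.
move=> hA; apply: cvg_rowP => i; rewrite mxE; under eq_fun do rewrite mxE.
by apply: cvg_sumR => j; apply: cvgM; [exact: cvg_cst | exact: cvg_coord].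
Qed.

Lemma cvg_row_mx (T : Type) (F : set_system T) {FF : Filter F} q p
  (a : T -> 'rV[R]_q) (b : T -> 'rV[R]_p) (la : 'rV[R]_q) (lb : 'rV[R]_p) :
  a t @[t --> F] --> la -> b t @[t --> F] --> lb ->
  row_mx (a t) (b t) @[t --> F] --> row_mx la lb.
Proof.
move=> ha hb; apply: cvg_rowP => i; case: (split_ordP i) => j ->.
  by rewrite row_mxEl; under eq_fun do rewrite row_mxEl; exact: cvg_coord.
by rewrite row_mxEr; under eq_fun do rewrite row_mxEr; exact: cvg_coord.
Qed.

Lemma row_mx_line n m (u x : 'rV[R]_n) (v y : 'rV[R]_m) (t : R) :
  row_mx (t *: u + x) (t *: v + y) = t *: row_mx u v + row_mx x y.
Proof. by rewrite scale_row_mx add_row_mx. Qed.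

(** A directional derivative sees the function only along its line, so a partial derivative with one
    block frozen is a derivative of the full function along a padded direction. *)
Lemma eq_derive_line (V V' W : normedModType R) (h : V -> W) (k : V' -> W) a v b w :
  (forall t : R, h (t *: v + a) = k (t *: w + b)) -> 'D_v h a = 'D_w k b.
Proof.
move=> E; rewrite /derive; suff -> : (fun t : R => t^-1 *: ((h \o shift a) (t *: v) - h a)) =
  (fun t : R => t^-1 *: ((k \o shift b) (t *: w) - k b)) by [].
by apply/funext => t /=; rewrite E; have := E 0; rewrite !scale0r !add0r => ->.
Qed.

Lemma gradxE n m (h : 'rV[R]_(n + m) -> R) x y :
  gradx h x y = lsubmx (grad h (row_mx x y)).
Proof.
apply/rowP => i; rewrite !mxE; apply: eq_derive_line => t.
by rewrite -{1}[y]add0r -{1}(scaler0 _ t) row_mx_line -delta_mx_lshift.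
Qed.

Lemma gradyE n m (h : 'rV[R]_(n + m) -> R) x y :
  grady h x y = rsubmx (grad h (row_mx x y)).
Proof.
apply/rowP => i; rewrite !mxE; apply: eq_derive_line => t.
by rewrite -{1}[x]add0r -{1}(scaler0 _ t) row_mx_line -delta_mx_rshift.
Qed.

Lemma differentiable_row_mxl n m (x : 'rV[R]_n) (y : 'rV[R]_m) :
  differentiable (fun x' => row_mx x' y) x.
Proof.
pose h : 'rV[R]_n -> 'rV[R]_(n + m) := mulmxr (row_mx 1%:M 0).
have hE z : h z = row_mx z 0 by rewrite /h /mulmxr mul_mx_row mulmx1 mulmx0.
have -> : (fun x' => row_mx x' y) = h + cst (row_mx 0 y).
  by apply/funext => z; rewrite fctE hE add_row_mx addr0 add0r.
apply: differentiableD => //; apply: linear_differentiable.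
suff : continuous h by []; rewrite (_ : h = fun z => row_mx z 0); last by apply: funext => z; exact: hE.
by move=> z; apply: (@cvg_row_mx _ (nbhs z)); [exact: cvg_id | exact: cvg_cst].
Qed.

Lemma differentiable_row_mxr n m (x : 'rV[R]_n) (y : 'rV[R]_m) :
  differentiable (fun y' => row_mx x y') y.
Proof.
pose h : 'rV[R]_m -> 'rV[R]_(n + m) := mulmxr (row_mx 0 1%:M).
have hE z : h z = row_mx 0 z by rewrite /h /mulmxr mul_mx_row mulmx1 mulmx0.
have -> : (fun y' => row_mx x y') = h + cst (row_mx x 0).
  by apply/funext => z; rewrite fctE hE add_row_mx addr0 add0r.
apply: differentiableD => //; apply: linear_differentiable.
suff : continuous h by []; rewrite (_ : h = fun z => row_mx 0 z); last by apply: funext => z; exact: hE.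
by move=> z; apply: (@cvg_row_mx _ (nbhs z)); [exact: cvg_cst | exact: cvg_id].
Qed.

Lemma eq_mulmx_row q p (A B : 'M[R]_(q, p)) :
  (forall v : 'rV_q, v *m A = v *m B) -> A = B.
Proof. by move=> AB; apply/row_matrixP => i; rewrite !rowE. Qed.

Lemma jacxE n m p (g : 'rV[R]_(n + m) -> 'rV[R]_p) x y :
  differentiable g (row_mx x y) -> jacx g x y = usubmx (jacobian g (row_mx x y)).
Proof.
move=> dg; apply: eq_mulmx_row => v; rewrite /jacx -deriveEjacobian; last first.
  exact: (differentiable_comp (differentiable_row_mxl x y)).
transitivity ('D_(row_mx v 0) g (row_mx x y)).
  by apply: eq_derive_line => t; rewrite -{1}[y]add0r -{1}(scaler0 _ t) row_mx_line.
by rewrite deriveEjacobian // -{1}(vsubmxK (jacobian g _)) mul_row_col mul0mx addr0.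
Qed.

Lemma jacyE n m p (g : 'rV[R]_(n + m) -> 'rV[R]_p) x y :
  differentiable g (row_mx x y) -> jacy g x y = dsubmx (jacobian g (row_mx x y)).
Proof.
move=> dg; apply: eq_mulmx_row => v; rewrite /jacy -deriveEjacobian; last first.
  exact: (differentiable_comp (differentiable_row_mxr x y)).
transitivity ('D_(row_mx 0 v) g (row_mx x y)).
  by apply: eq_derive_line => t; rewrite -{1}[x]add0r -{1}(scaler0 _ t) row_mx_line.
by rewrite deriveEjacobian // -{1}(vsubmxK (jacobian g _)) mul_row_col mul0mx add0r.
Qed.

Lemma is_derive_grad n (h : 'rV[R]_n -> R) u v :
  differentiable (h : _ -> R^o) u -> is_derive u v (h : _ -> R^o) (dotp (grad h u) v).
Proof.
move=> dh; apply: DeriveDef; first exact: diff_derivable.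
rewrite deriveE // {1}(row_sum_delta v) linear_sum; apply: eq_bigr => i _.
by rewrite linearZ /= mxE deriveE // mulrC.
Qed.

Lemma grad_is_derive n (h : 'rV[R]_n -> R) u G :
  (forall v, is_derive u v (h : _ -> R^o) (dotp G v)) -> grad h u = G.
Proof. by move=> D; apply/rowP => i; rewrite mxE; have [_ ->] := D (delta_mx 0 i); rewrite dotp_delta. Qed.

(** Derivatives of curves are taken coordinate by coordinate, so that scalar rules suffice for inner
    products. *)
Definition row_derive p (a : R -> 'rV[R]_p) (t : R) (da : 'rV[R]_p) :=
  forall i, is_derive t 1 (fun s => a s 0 i : R^o) (da 0 i).

Lemma row_derive_line p (q z : 'rV[R]_p) t : row_derive (fun s => s *: q + z) t q.
Proof.
move=> i; rewrite (_ : (fun s => _) = (fun s => s * q 0 i + z 0 i)).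
  by apply: is_derive_eq; rewrite /GRing.scale /= !mulr0 mulr1 add0r addr0.
by apply/funext => s; rewrite !mxE.
Qed.

Lemma row_derive_cst p (z : 'rV[R]_p) t : row_derive (fun=> z) t 0.
Proof. by move=> i; rewrite mxE; exact: is_derive_cst. Qed.

Lemma row_deriveD p (a b : R -> 'rV[R]_p) t da db :
  row_derive a t da -> row_derive b t db -> row_derive (fun s => a s + b s) t (da + db).
Proof.
move=> ha hb i; rewrite mxE (_ : (fun s => _) = (fun s => a s 0 i + b s 0 i : R^o)).
  exact: (is_deriveD (ha i) (hb i)).
by apply/funext => s; rewrite !mxE.
Qed.

Lemma row_deriveZ p (a : R -> 'rV[R]_p) t da (k : R) :
  row_derive a t da -> row_derive (fun s => k *: a s) t (k *: da).
Proof.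
move=> ha i; rewrite mxE (_ : (fun s => _) = (fun s => k * a s 0 i : R^o)).
  exact: (is_deriveZ k (ha i)).
by apply/funext => s; rewrite !mxE.
Qed.

Lemma row_derive_comp_line q p (g : 'rV[R]_q -> 'rV[R]_p) u v (t : R) :
  differentiable g (t *: v + u) ->
  row_derive (fun s => g (s *: v + u)) t (v *m jacobian g (t *: v + u)).
Proof.
move=> dg i; have D := @diff_derivable _ _ _ _ _ v dg.
apply: (@is_derive_line R _ _ (fun w => g w 0 i : R^o)); apply: DeriveDef.
  exact: (derivable_mxP _ _ _).1.
by rewrite -deriveEjacobian // derive_mx // mxE.
Qed.

Lemma is_derive_sumR p (a : 'I_p -> R -> R) (t : R) (da : 'I_p -> R) :
  (forall i, is_derive t 1 (a i : R -> R^o) (da i)) ->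
  is_derive t 1 (fun s => \sum_(i < p) a i s : R^o) (\sum_(i < p) da i).
Proof.
move=> ha; have := is_derive_sum ha; congr (is_derive _ _ _ _).
by apply/funext => s; rewrite fct_sumE.
Qed.

Lemma is_derive_dotp p (a b : R -> 'rV[R]_p) (t : R) da db :
  row_derive a t da -> row_derive b t db ->
  is_derive t 1 (fun s => dotp (a s) (b s) : R^o) (dotp (a t) db + dotp da (b t)).
Proof.
move=> ha hb; rewrite -big_split; apply: is_derive_sumR => i.
have := is_deriveM (ha i) (hb i); rewrite /GRing.scale /= => D.
by apply: is_derive_eq; rewrite (mulrC (da 0 i)).
Qed.

(** Squaring removes the kink of the positive part: for all signs of [x] and [s + x] the first-order
    error is at most [s ^+ 2]. This is why the gap is differentiable although the multiplier itself
    need not be. *)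
Lemma is_derive_pos2 (x : R) : is_derive x 1 (fun s => Num.max 0 s ^+ 2 : R^o) (2 * Num.max 0 x).
Proof.
apply: is_derive_lineP => e e0; near=> s.
have se : `|s| <= e by near: s; exists e => //= s; rewrite /ball_ /= sub0r normrN => /ltW.
apply: (@le_trans _ _ (`|s| * `|s|)); last by rewrite ler_wpM2r.
rewrite -normrM -expr2 (ger0_norm (sqr_ge0 s)) ler_norml.
have [h1|h1] := leP 0 x; have [h2|h2] := leP 0 (s + x); apply/andP; split; nra.
Unshelve. all: by end_near. Qed.

Lemma is_derive_pospart p (a : R -> 'rV[R]_p) (t : R) da :
  row_derive a t da ->
  is_derive t 1 (fun s => enorm (pospart (a s)) ^+ 2 : R^o) (2 * dotp (pospart (a t)) da).
Proof.
move=> ha; rewrite (_ : (fun s => _) = (fun s => \sum_(i < p) Num.max 0 (a s 0 i) ^+ 2)).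
  rewrite /dotp mulr_sumr; apply: is_derive_sumR => i; rewrite mxE mulrA.
  exact: (@is_derive1_comp R (fun s => Num.max 0 s ^+ 2) (fun s => a s 0 i) _ _ _ (is_derive_pos2 _) (ha i)).
by apply/funext => s; rewrite sqr_enorm; apply: eq_bigr => i _; rewrite mxE expr2.
Qed.

End RowCalculus.

(** * Lipschitz maps *)

Section LipschitzOn.
Context {R : realType} {T : Type}.
Variables (A : set T) (d : T -> T -> R).
Hypothesis d_ge0 : forall s t, 0 <= d s t.

(** The constant is left existential, since only its existence matters later; the abstract source
    allows pairs (w, theta) with the sum of the two distances. *)
Definition lip_on q (h : T -> 'rV[R]_q) :=
  exists2 L, 0 <= L & forall s t, A s -> A t -> enorm (h s - h t) <= L * d s t.

(** Matrices are controlled through their action on Euclidean vectors, which follows from [jac_norm]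
    because the sup norm is at most the Euclidean one. *)
Definition mxlip_on q p (J : T -> 'M[R]_(q, p)) :=
  exists2 L, 0 <= L & forall s t z, A s -> A t ->
    enorm (z *m (J s - J t)^T) <= L * d s t * enorm z.

Lemma lip_onD q (h k : T -> 'rV[R]_q) :
  lip_on h -> lip_on k -> lip_on (fun s => h s + k s).
Proof.
move=> [L L0 hL] [M M0 kM]; exists (L + M) => [|s t As At]; first exact: addr_ge0.
rewrite opprD addrACA (le_trans (ler_enormD _ _)) // mulrDl.
by rewrite lerD ?hL ?kM.
Qed.

Lemma lip_onZ q a (h : T -> 'rV[R]_q) : lip_on h -> lip_on (fun s => a *: h s).
Proof.
move=> [L L0 hL]; exists (`|a| * L) => [|s t As At]; first by rewrite mulr_ge0.
by rewrite -scalerBr enormZ -mulrA ler_wpM2l ?hL.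
Qed.

Lemma lip_onN q (h : T -> 'rV[R]_q) : lip_on h -> lip_on (fun s => - h s).
Proof.
by move=> [L L0 hL]; exists L => // s t As At; rewrite -opprD enormN hL.
Qed.

Lemma lip_onB q (h k : T -> 'rV[R]_q) :
  lip_on h -> lip_on k -> lip_on (fun s => h s - k s).
Proof. by move=> hh hk; apply: lip_onD => //; exact: lip_onN. Qed.

Lemma lip_on_row_mx q p (h : T -> 'rV[R]_q) (k : T -> 'rV[R]_p) :
  lip_on h -> lip_on k -> lip_on (fun s => row_mx (h s) (k s)).
Proof.
move=> [L L0 hL] [M M0 kM]; exists (L + M) => [|s t As At]; first exact: addr_ge0.
rewrite opp_row_mx add_row_mx (le_trans (enorm_row_mx_le _ _)) // mulrDl.
by rewrite lerD ?hL ?kM.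
Qed.

Lemma lip_on_contract q p (b : 'rV[R]_q -> 'rV[R]_p) (h : T -> 'rV[R]_q) :
  (forall u v, enorm (b u - b v) <= enorm (u - v)) ->
  lip_on h -> lip_on (fun s => b (h s)).
Proof.
by move=> hb [L L0 hL]; exists L => // s t As At; rewrite (le_trans (hb _ _)) ?hL.
Qed.

Lemma lip_on_lsubmx q p (h : T -> 'rV[R]_(q + p)) :
  lip_on h -> lip_on (fun s => lsubmx (h s)).
Proof. by apply: lip_on_contract => u v; rewrite -linearB enorm_lsubmx. Qed.

Lemma lip_on_rsubmx q p (h : T -> 'rV[R]_(q + p)) :
  lip_on h -> lip_on (fun s => rsubmx (h s)).
Proof. by apply: lip_on_contract => u v; rewrite -linearB enorm_rsubmx. Qed.

Lemma lip_on_comp q p (S : set 'rV[R]_q) (k : 'rV[R]_q -> 'rV[R]_p) L (h : T -> 'rV[R]_q) :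
  lipschitz_norm (@enorm R p) L S k -> (forall s, A s -> S (h s)) ->
  lip_on h -> lip_on (fun s => k (h s)).
Proof.
move=> [L0 kL] hS [M M0 hM]; exists (L * M) => [|s t As At]; first exact: mulr_ge0.
by rewrite (le_trans (kL _ _ (hS _ As) (hS _ At))) // -mulrA ler_wpM2l ?hM.
Qed.

Lemma mxlip_on_comp q p l (S : set 'rV[R]_l) (K : 'rV[R]_l -> 'M[R]_(q, p)) L
    (h : T -> 'rV[R]_l) (J : T -> 'M[R]_(q, p)) : (forall s, J s = K (h s)) ->
  lipschitz_norm (@jac_norm R q p) L S K -> (forall s, A s -> S (h s)) ->
  lip_on h -> mxlip_on J.
Proof.
move=> /funext -> [L0 kL] hS [M M0 hM]; exists (L * M) => [|s t z As At]; first exact: mulr_ge0.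
rewrite (le_trans (enorm_mulmx_jac _ _)) //.
apply: (@le_trans _ _ (L * M * d s t * `|z|)).
  rewrite ler_wpM2r // (le_trans (kL _ _ (hS _ As) (hS _ At))) //.
  by rewrite -mulrA ler_wpM2l ?hM.
by rewrite ler_wpM2l ?mulr_ge0 // mxnorm_le_enorm.
Qed.

Hypothesis d_bounded : exists D, forall s t, A s -> A t -> d s t <= D.

Lemma lip_on_bounded q (h : T -> 'rV[R]_q) : lip_on h ->
  exists2 M, 0 <= M & forall s, A s -> enorm (h s) <= M.
Proof.
have [[s0 As0]|noA] := pselect (A !=set0); last first.
  by exists 0 => // s As; case: noA; exists s.
have [D dD] := d_bounded; move=> [L L0 hL].
have D0 : 0 <= D := le_trans (d_ge0 s0 s0) (dD _ _ As0 As0).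
exists (L * D + enorm (h s0)) => [|s As]; first by rewrite addr_ge0 ?mulr_ge0 ?enorm_ge0.
rewrite -{1}(subrK (h s0) (h s)) (le_trans (ler_enormD _ _)) // lerD2r.
by rewrite (le_trans (hL _ _ As As0)) // ler_wpM2l // dD.
Qed.

(** Product rule for bounded Lipschitz maps. The matrices are bounded by comparison with their value
    at a base point [s0], hence the separate case of an empty [A]. *)
Lemma lip_on_mulmx q p (a : T -> 'rV[R]_p) (J : T -> 'M[R]_(q, p)) :
  lip_on a -> mxlip_on J -> lip_on (fun s => a s *m (J s)^T).
Proof.
move=> la; have [M M0 aM] := lip_on_bounded la; move: la => [La La0 aL] [LJ LJ0 JL].
have [[s0 As0]|noA] := pselect (A !=set0); last first.
  by exists 0 => // s t As; case: noA; exists s.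
have [D dD] := d_bounded.
have D0 : 0 <= D := le_trans (d_ge0 s0 s0) (dD _ _ As0 As0).
have [B B0 HB] := enorm_mulmx_bound (J s0).
have JB s z : A s -> enorm (z *m (J s)^T) <= (B + LJ * D) * enorm z.
  move=> As; rewrite -(subrK (J s0) (J s)) linearD mulmxDr addrC mulrDl.
  rewrite (le_trans (ler_enormD _ _)) // lerD //.
    by rewrite (le_trans (HB z)) // ler_wpM2l // mxnorm_le_enorm.
  by rewrite (le_trans (JL _ _ _ As As0)) // ler_wpM2r ?enorm_ge0 // ler_wpM2l // dD.
exists ((B + LJ * D) * La + LJ * M) => [|s t As At].
  by rewrite addr_ge0 ?mulr_ge0 ?addr_ge0 ?mulr_ge0.
have -> : a s *m (J s)^T - a t *m (J t)^T = (a s - a t) *m (J s)^T + a t *m (J s - J t)^T.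
  by rewrite linearB mulmxBr mulmxBl addrA subrK.
rewrite (le_trans (ler_enormD _ _)) // mulrDl lerD //.
  by rewrite (le_trans (JB _ _ As)) // -mulrA ler_wpM2l ?aL // addr_ge0 ?mulr_ge0.
by rewrite (le_trans (JL _ _ _ As At)) // [leRHS]mulrAC ler_wpM2l ?mulr_ge0 // aM.
Qed.

End LipschitzOn.

(** * Lyapunov argument *)

Section Rates.
Context {R : realType}.

(** In the application [a] is c / alpha_k, [D] the length of the outer step, [e] and [e'] the
    distances of theta^k and theta^(k+1) to the minimizer at w^k, and [en] the distance of
    theta^(k+1) to the minimizer at w^(k+1). *)
Lemma lyapunov_decrease (rho L3 C L : R) : 0 <= rho < 1 -> 0 <= L3 -> 0 <= C -> 0 <= L ->
  exists M A : R, [/\ 0 <= M, 0 <= A &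
    forall a P Pn e e' en D : R, A <= a -> 0 <= e' -> 0 <= en -> 0 <= D ->
      e' ^+ 2 <= rho * e ^+ 2 -> en <= e' + L3 * D ->
      Pn <= P - a * D ^+ 2 + C * e' * D + L * D ^+ 2 ->
      Pn + M * en ^+ 2 + (D ^+ 2 + e ^+ 2) <= P + M * e ^+ 2].
Proof.
move=> /andP[rho0 rho1] L30 C0 L0; pose del := (1 - rho) / 2.
have del0 : 0 < del by rewrite /del; lra.
pose M := (C / 2 + 1) / del; pose N := (1 + del^-1) * L3 ^+ 2.
have M0 : 0 <= M by rewrite divr_ge0 ?(ltW del0) //; lra.
have N0 : 0 <= N by rewrite mulr_ge0 ?sqr_ge0 // addr_ge0 // invr_ge0 ltW.
have MN0 : 0 <= M * N by exact: mulr_ge0.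
(* The threshold on [a] pays for the descent error [L], the cross term [C / 2], the gained [D ^+ 2],
   and the drift [M * N] of the minimizer. *)
exists M, (L + C / 2 + 1 + M * N); split => //; first lra.
move=> a P Pn e e' en D Aa e'0 en0 D0 he hen hP.
(* [del] weights Young's inequality so that (1 + del) rho <= 1 - del, and [M] is the value
   for which the resulting gain M del e^2 pays for C / 2 e^2 + e^2. *)
have h1 : C * e' * D <= C / 2 * (e' ^+ 2 + D ^+ 2).
  rewrite -mulrA (_ : C / 2 * _ = C * ((e' ^+ 2 + D ^+ 2) / 2)); last by field.
  by rewrite ler_wpM2l //; have := sqr_ge0 (e' - D); nra.
have h2 : en ^+ 2 <= (1 + del) * e' ^+ 2 + N * D ^+ 2.
  apply: (@le_trans _ _ ((e' + L3 * D) ^+ 2)).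
    by rewrite ler_pXn2r ?nnegrE // (le_trans en0).
  have : 0 <= del * (e' - del^-1 * (L3 * D)) ^+ 2 by rewrite mulr_ge0 ?sqr_ge0 // ltW.
  have -> : del * (e' - del^-1 * (L3 * D)) ^+ 2 =
    del * e' ^+ 2 - 2 * (e' * (L3 * D)) + del^-1 * (L3 * D) ^+ 2 by field; rewrite gt_eqF.
  rewrite /N; lra.
have h3 : M * en ^+ 2 <= M * ((1 + del) * e' ^+ 2 + N * D ^+ 2) by rewrite ler_wpM2l.
have h4 : (1 + del) * e' ^+ 2 <= (1 - del) * e ^+ 2.
  apply: (@le_trans _ _ ((1 + del) * (rho * e ^+ 2))); first by rewrite ler_wpM2l //; lra.
  by rewrite mulrA ler_wpM2r ?sqr_ge0 // /del; nra.
have h5 : M * ((1 + del) * e' ^+ 2) <= M * ((1 - del) * e ^+ 2) by rewrite ler_wpM2l.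
have h6 : M * del * e ^+ 2 = (C / 2 + 1) * e ^+ 2 by rewrite /M divfK // gt_eqF.
have h7 : (L + C / 2 + 1 + M * N) * D ^+ 2 <= a * D ^+ 2 by rewrite ler_wpM2r ?sqr_ge0.
have h8 : C / 2 * e' ^+ 2 <= C / 2 * e ^+ 2.
  rewrite ler_wpM2l ?divr_ge0 // (le_trans he) // ler_piMl ?sqr_ge0 //; exact: ltW.
lra.
Qed.

Lemma sum_le_of_decrease (V h : nat -> R) (M : R) :
  (forall k, V k.+1 + h k <= V k) -> (forall k, M <= V k) ->
  forall K, \sum_(k < K) h k <= V 0%N - M.
Proof.
move=> dec low K; suff : \sum_(k < K) h k <= V 0%N - V K by have := low K; lra.
elim: K => [|K IH]; first by rewrite big_ord0 subrr.
by rewrite big_ord_recr /=; have := dec K; lra.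
Qed.

Lemma bigmin_eqO_sqrt (u : nat -> R) (Q : R) : (forall k, 0 <= u k) ->
  (forall K, \sum_(k < K) u k ^+ 2 <= Q) ->
  (fun K : nat => \big[Num.min/u 0%N]_(k < K.+1) u k : R^o) =O_\oo
  (fun K : nat => (Num.sqrt (K%:R : R))^-1 : R^o).
Proof.
move=> u0 uQ; have Q0 : 0 <= Q by have := uQ 0%N; rewrite big_ord0.
(* The sum of K + 1 squares is at least (K + 1) times the squared minimum; adding 1 keeps the
   constant positive when [Q] is 0. *)
apply/eqO_exP; exists (Num.sqrt Q + 1); first by rewrite ltr_wpDl ?sqrtr_ge0.
near=> K; set b := \big[_/_]_(_ < _) _.
(* At K = 0 the comparison function takes the default value [0^-1 = 0], so the bound starts at K =
   1. *)
have K0 : (0 < K)%N by near: K; exact: nbhs_infty_gt.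
have b0 : 0 <= b by apply/bigmin_geP.
have bu (k : 'I_K.+1) : b <= u k by exact: bigmin_le.
have s0 : 0 < Num.sqrt (K%:R : R) by rewrite sqrtr_gt0 ltr0n.
rewrite (ger0_norm b0) gtr0_norm ?invr_gt0 // ler_pdivlMr //.
apply: (@le_trans _ _ (Num.sqrt Q)); last by rewrite lerDl.
rewrite -(@ler_pXn2r _ 2) ?nnegrE ?mulr_ge0 ?sqrtr_ge0 // exprMn !sqr_sqrtr //.
apply: le_trans (uQ K.+1); apply: (@le_trans _ _ (\sum_(k < K.+1) b ^+ 2)).
  by rewrite sumr_const card_ord -[leRHS]mulr_natr ler_wpM2l ?sqr_ge0 // ler_nat.
by apply: ler_sum => k _; rewrite ler_pXn2r ?nnegrE.
Unshelve. all: by end_near. Qed.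

End Rates.

(** * Gap function and iterates *)

Section Problem.
Context {R : realType} {n m p : nat}.
Variables (X : set 'rV[R]_n) (Y : set 'rV[R]_m) (r : R).
Variables (F f : 'rV[R]_(n + m) -> R) (g : 'rV[R]_(n + m) -> 'rV[R]_p).
Variables (LF Lf Lg Lg1 Lg2 gamma1 gamma2 c : R).
Hypotheses (X_convex : convex_set X) (Y_convex : convex_set Y) (r_ge0 : 0 <= r).
Hypotheses (X_compact : compact X) (Y_compact : compact Y).
Hypothesis F_assumption : upper_assumption X Y F LF.
Hypothesis f_assumption : lower_objective_assumption X Y f Lf.
Hypothesis g_assumption : constraint_assumption X Y g Lg Lg1 Lg2.
Hypotheses (gamma1_gt0 : 0 < gamma1) (gamma2_gt0 : 0 < gamma2) (c_gt0 : 0 < c).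

Local Notation XY := (setXrow X Y).
Local Notation XYZ := (setXrow XY (@box R p r)).
Local Notation px w := (lsubmx (lsubmx w)).
Local Notation py w := (rsubmx (lsubmx w)).
Local Notation pz w := (rsubmx w).

Implicit Types (w v : 'rV[R]_(n + m + p)) (th : 'rV[R]_m).

Definition multiplier w : 'rV[R]_p :=
  pospart (pz w + gamma2 *: g (row_mx (px w) (py w))).

(** The inner point is left free: theta^(k+1) gives the step of the algorithm, the exact minimizer
    gives the gradient of psi_c divided by c. *)
Definition direction w th : 'rV[R]_(n + m + p) :=
  row_mx (row_mx (dir_x F f g c (px w) (py w) (pz w) th (multiplier w))
                 (dir_y F f g gamma1 c (px w) (py w) th (multiplier w)))
         (dir_z g gamma2 (px w) (pz w) th (multiplier w)).

Definition prox_objective w th : R :=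
  lagrangian f g (px w) th (pz w) + (2 * gamma1)^-1 * enorm (th - py w) ^+ 2.

Lemma XY_row x y : X x -> Y y -> XY (row_mx x y).
Proof. by split; rewrite ?row_mxKl ?row_mxKr. Qed.

Let XYZ_x w : XYZ w -> X (px w). Proof. by case=> -[]. Qed.
Let XYZ_y w : XYZ w -> Y (py w). Proof. by case=> -[]. Qed.
Let XYZ_z w : XYZ w -> box r (pz w). Proof. by case. Qed.

Let convex_XYZ : convex_set XYZ.
Proof. by apply: convex_setXrow; [exact: convex_setXrow | exact: convex_box]. Qed.

Let f_near u : XY u -> \forall u' \near u, differentiable (f : _ -> R^o) u'.
Proof.
have [_ [U [oU XYU fU]] _] := f_assumption => /XYU Uu.
by apply: filterS (open_nbhs_nbhs (conj oU Uu)) => u' /fU[].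
Qed.

Let f_diff u : XY u -> differentiable (f : _ -> R^o) u.
Proof. by move=> /f_near/nbhs_singleton. Qed.

Let f_grad_cont u : XY u -> {for u, continuous (grad f)}.
Proof. by have [_ [U [oU XYU fU]] _] := f_assumption => /XYU/fU[]. Qed.

Let g_near u : XY u -> \forall u' \near u, differentiable g u'.
Proof.
have [_ _ [U [oU XYU gU]] _ _] := g_assumption => /XYU Uu.
by apply: filterS (open_nbhs_nbhs (conj oU Uu)) => u' /gU[].
Qed.

Let g_diff u : XY u -> differentiable g u.
Proof. by move=> /g_near/nbhs_singleton. Qed.

Let g_jac_cont u : XY u -> {for u, continuous (jacobian g)}.
Proof. by have [_ _ [U [oU XYU gU]] _ _] := g_assumption => /XYU/gU[]. Qed.

(** * Derivative of the prox objective along lines in (x, y, z) *)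

Let px_line t v w : px (t *: v + w) = t *: px v + px w.
Proof. by rewrite !linearP. Qed.
Let py_line t v w : py (t *: v + w) = t *: py v + py w.
Proof. by rewrite !linearP. Qed.
Let pz_line t v w : pz (t *: v + w) = t *: pz v + pz w.
Proof. by rewrite linearP. Qed.

Let row_px_line t v w th :
  row_mx (px (t *: v + w)) th = t *: row_mx (px v) 0 + row_mx (px w) th.
Proof. by rewrite px_line -{1}[th]add0r -{1}(scaler0 _ t) row_mx_line. Qed.

(** The derivative in [t] of [prox_objective (t *: v + w) th] at fixed [th]; it serves as [H'] in
    Danskin's theorem. *)
Definition prox_objective' w v t th : R :=
  let w' := t *: v + w in
  dotp (grad f (row_mx (px w') th)) (row_mx (px v) 0)
  + (dotp (pz w') (row_mx (px v) 0 *m jacobian g (row_mx (px w') th))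
     + dotp (pz v) (g (row_mx (px w') th)))
  - gamma1^-1 * dotp (th - py w') (py v).

Lemma is_derive_prox_objective w v t th :
  differentiable (f : _ -> R^o) (row_mx (px (t *: v + w)) th) ->
  differentiable g (row_mx (px (t *: v + w)) th) ->
  is_derive t 1 (fun s => prox_objective (s *: v + w) th : R^o) (prox_objective' w v t th).
Proof.
rewrite /prox_objective' row_px_line => df dg.
rewrite (_ : (fun s => _) = (fun s => f (s *: row_mx (px v) 0 + row_mx (px w) th)
  + dotp (s *: pz v + pz w) (g (s *: row_mx (px v) 0 + row_mx (px w) th))
  + (2 * gamma1)^-1 * dotp (s *: - py v + (th - py w)) (s *: - py v + (th - py w)))); last first.
  apply/funext => s; rewrite /prox_objective /lagrangian row_px_line pz_line py_line sqr_enorm.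
  by rewrite scalerN opprD addrCA.
have Df := is_derive_line (is_derive_grad (row_mx (px v) 0) df).
have Dg := is_derive_dotp (row_derive_line (pz v) (pz w) t) (row_derive_comp_line dg).
have Dq := is_derive_dotp (row_derive_line (- py v) (th - py w) t)
  (row_derive_line (- py v) (th - py w) t).
apply: is_derive_eq; rewrite !pz_line py_line /GRing.scale /=; congr (_ + _ + _).
have -> : t *: - py v + (th - py w) = th - (t *: py v + py w).
  by rewrite scalerN opprD addrCA.
by rewrite (dotpC (- _)) dotpNr; field; rewrite gt_eqF.
Qed.

Let cvg_line w v th : (fun q : R * 'rV[R]_m => q.1 *: v + w) q @[q --> (0, th)] --> w.
Proof.
rewrite -[X in _ --> X]add0r -(scale0r v); apply: cvgD; last exact: cvg_cst.
by apply: cvgZr_tmp; exact: cvg_fst.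
Qed.

Lemma cvg_px_line w v th :
  row_mx (px (q.1 *: v + w)) q.2 @[q --> ((0 : R), th)] --> row_mx (px w) th.
Proof.
under eq_fun do rewrite px_line.
apply: cvg_row_mx; last exact: cvg_snd.
rewrite -[X in _ --> X]add0r -(scale0r (px v)); apply: cvgD; last exact: cvg_cst.
by apply: cvgZr_tmp; exact: cvg_fst.
Qed.

Let f_cont u : XY u -> f u' @[u' --> u] --> f u.
Proof. by move=> /f_diff/differentiable_continuous. Qed.

Let g_cont u : XY u -> g u' @[u' --> u] --> g u.
Proof. by move=> /g_diff/differentiable_continuous. Qed.

Lemma cvg_prox_objective w v th : XYZ w -> Y th ->
  prox_objective (q.1 *: v + w) q.2 @[q --> ((0 : R), th)] --> prox_objective w th.
Proof.
move=> ww Yth; have XYw := XY_row (XYZ_x ww) Yth.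
have C := @cvg_px_line w v th; have CL := @cvg_line w v th.
have Cy : py (q.1 *: v + w) @[q --> ((0 : R), th)] --> py w.
  exact: (cvg_comp _ _ (cvg_comp _ _ CL (@continuous_lsubmx R 1 _ _ w)) (@continuous_rsubmx R 1 _ _ _)).
have Cz : pz (q.1 *: v + w) @[q --> ((0 : R), th)] --> pz w.
  exact: (cvg_comp _ _ CL (@continuous_rsubmx R 1 _ _ w)).
rewrite /prox_objective; under eq_fun do rewrite sqr_enorm; rewrite sqr_enorm.
have Cd : q.2 - py (q.1 *: v + w) @[q --> ((0 : R), th)] --> th - py w.
  by apply: cvgB => //; exact: cvg_snd.
apply: cvgD; last by apply: cvgM; [exact: cvg_cst | exact: cvg_dotp].
apply: cvgD; first exact: (cvg_comp _ _ C (f_cont XYw)).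
by apply: cvg_dotp => //; exact: (cvg_comp _ _ C (g_cont XYw)).
Qed.

Lemma cvg_prox_objective' w v th : XYZ w -> Y th ->
  prox_objective' w v q.1 q.2 @[q --> ((0 : R), th)] --> prox_objective' w v 0 th.
Proof.
move=> ww Yth; have XYw := XY_row (XYZ_x ww) Yth.
have C := @cvg_px_line w v th; have CL := @cvg_line w v th.
have Cy : py (q.1 *: v + w) @[q --> ((0 : R), th)] --> py w.
  exact: (cvg_comp _ _ (cvg_comp _ _ CL (@continuous_lsubmx R 1 _ _ w)) (@continuous_rsubmx R 1 _ _ _)).
have Cz : pz (q.1 *: v + w) @[q --> ((0 : R), th)] --> pz w.
  exact: (cvg_comp _ _ CL (@continuous_rsubmx R 1 _ _ w)).
have Cd : q.2 - py (q.1 *: v + w) @[q --> ((0 : R), th)] --> th - py w.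
  by apply: cvgB => //; exact: cvg_snd.
rewrite /prox_objective' scale0r add0r.
apply: cvgB; last by apply: cvgM; [exact: cvg_cst | apply: cvg_dotp => //; exact: cvg_cst].
apply: cvgD; first by apply: cvg_dotp; [exact: (cvg_comp _ _ C (f_grad_cont XYw)) | exact: cvg_cst].
apply: cvgD; last by apply: cvg_dotp; [exact: cvg_cst | exact: (cvg_comp _ _ C (g_cont XYw))].
by apply: cvg_dotp => //; apply: cvg_mulmx; exact: (cvg_comp _ _ C (g_jac_cont XYw)).
Qed.

(** Points near (0, th) may leave X x Y; the open sets of (A2) and (A3) provide differentiability
    there. *)
Lemma near_is_derive_prox_objective w v th : XYZ w -> Y th ->
  \forall q \near ((0 : R), th), is_derive (q.1 : R) 1
    (fun t => prox_objective (t *: v + w) q.2 : R^o) (prox_objective' w v q.1 q.2).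
Proof.
move=> ww Yth; have XYw := XY_row (XYZ_x ww) Yth.
have C := @cvg_px_line w v th.
have Nf : \forall q \near ((0 : R), th),
  differentiable (f : _ -> R^o) (row_mx (px (q.1 *: v + w)) q.2) := C _ (f_near XYw).
have Ng : \forall q \near ((0 : R), th),
  differentiable g (row_mx (px (q.1 *: v + w)) q.2) := C _ (g_near XYw).
by near=> q; apply: is_derive_prox_objective; near: q.
Unshelve. all: by end_near. Qed.

(** * Separation of the gap into a multiplier part and a prox part *)

Definition gap_upper w : R := f (row_mx (px w) (py w))
  + (2 * gamma2)^-1 * (enorm (multiplier w) ^+ 2 - enorm (pz w) ^+ 2).

Let gap_term w la : R := lagrangian f g (px w) (py w) la
  - (2 * gamma2)^-1 * enorm (la - pz w) ^+ 2.

(* Completing the square: the projected multiplier maximizes the part of the gap that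
   depends on the multiplier. *)
Lemma gap_term_gap w la : gap_upper w - gap_term w la =
  (2 * gamma2)^-1 * (enorm (la - multiplier w) ^+ 2
    - 2 * dotp (pz w + gamma2 *: g (row_mx (px w) (py w)) - multiplier w) (la - multiplier w)).
Proof.
have := dotp_pospart (pz w + gamma2 *: g (row_mx (px w) (py w))); rewrite -/(multiplier w).
rewrite /gap_upper /gap_term /lagrangian !sqr_enorm.
move: (multiplier w) (pz w) (g _) (f _) => l z b a.
rewrite !(dotpBr, dotpBl, dotpDr, dotpDl, dotpZl, dotpZr) (dotpC l la) (dotpC z la) (dotpC b la).
move=> h; have -> : dotp l l = dotp z l + gamma2 * dotp b l by lra.
by field; rewrite gt_eqF.
Qed.

Lemma gap_term_le w la : orthant la -> gap_term w la <= gap_upper w.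
Proof.
move=> la0; rewrite -subr_ge0 gap_term_gap.
rewrite mulr_ge0 ?invr_ge0 ?mulr_ge0 ?(ltW gamma2_gt0) //.
have := pospart_vi (pz w + gamma2 *: g (row_mx (px w) (py w))) la0.
rewrite -/(multiplier w); have := sqr_ge0 (enorm (la - multiplier w)); lra.
Qed.

Lemma gap_term_multiplier w : gap_term w (multiplier w) = gap_upper w.
Proof.
apply/esym/eqP; rewrite -subr_eq0 gap_term_gap subrr enorm0 dotpC dotp0l.
by rewrite expr0n mulr0 subrr mulr0.
Qed.

Let gap_at w : R := gap Y f g gamma1 gamma2 (px w) (py w) (pz w).

(** The supremum separates in theta and lambda, and [l] bounds it above. A lower bound replaces the
    minimizer because Danskin's theorem also uses points [w] off X x Y x Z. *)
Lemma gap_bounds w th l : Y th -> (forall a, Y a -> l <= prox_objective w a) ->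
  l <= gap_upper w - gap_at w <= prox_objective w th.
Proof.
move=> Yth lP.
have ub : ubound [set gap_term w tl.2 - prox_objective w tl.1 | tl in Y `*` @orthant R p]
    (gap_upper w - l).
  by move=> _ [[a la] /= [Ya la0] <-]; rewrite lerB ?lP // gap_term_le.
have E : gap_at w = sup [set gap_term w tl.2 - prox_objective w tl.1 | tl in Y `*` @orthant R p].
  congr sup; apply/seteqP; split => _ [tl tlP <-]; exists tl => //;
    by rewrite /= /gap_term /prox_objective; ring.
have S : ([set gap_term w tl.2 - prox_objective w tl.1 | tl in Y `*` @orthant R p])
    (gap_upper w - prox_objective w th).
  exists (th, multiplier w); last by rewrite /= gap_term_multiplier.
  by split => //=; exact: orthant_pospart.
rewrite E; apply/andP; split.
  by rewrite lerBrDl -lerBrDr; apply: ge_sup => //; eexists; exact: S.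
by rewrite lerBlDl -lerBlDr; apply: ub_le_sup => //; eexists; exact: ub.
Qed.

Lemma gapE w th : is_min Y (prox_objective w) th -> gap_at w = gap_upper w - prox_objective w th.
Proof.
move=> [Yth thmin]; have := gap_bounds Yth thmin; lra.
Qed.

(** Testing with theta = y and lambda = z kills both quadratic terms, and the two Lagrangians
    cancel. *)
Lemma gap_ge0 w th : XYZ w -> is_min Y (prox_objective w) th -> 0 <= gap_at w.
Proof.
move=> ww thP; rewrite (gapE thP) subr_ge0 (le_trans (thP.2 _ (XYZ_y ww))) //.
have z0 : orthant (pz w) by move=> i; have /andP[] := XYZ_z ww i.
apply: (le_trans _ (gap_term_le w z0)).
by rewrite /prox_objective /gap_term !subrr !enorm0 expr0n !mulr0 subr0 addr0.
Qed.

(** * Strong convexity and smoothness of the prox objective in theta *)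

Lemma is_derive_lagrangian_y x th (z : 'rV[R]_p) (v : 'rV[R]_m) : X x -> Y th ->
  is_derive th v (fun th => lagrangian f g x th z : R^o)
    (dotp (grady f x th + z *m (jacy g x th)^T) v).
Proof.
move=> Xx Yth; have XYw := XY_row Xx Yth.
apply: is_derive_of_line.
have E s : row_mx x (s *: v + th) = s *: row_mx 0 v + row_mx x th.
  by rewrite -{1}[x]add0r -{1}(scaler0 _ s) row_mx_line.
rewrite /lagrangian; under eq_fun do rewrite E.
have E0 : 0 *: row_mx 0 v + row_mx x th = row_mx x th by rewrite scale0r add0r.
have df : differentiable (f : _ -> R^o) (0 *: row_mx 0 v + row_mx x th).
  by rewrite E0; exact: f_diff.
have dg : differentiable g (0 *: row_mx 0 v + row_mx x th).
  by rewrite E0; exact: g_diff.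
have Df := is_derive_line (is_derive_grad (row_mx 0 v) df).
have Dg := is_derive_dotp (row_derive_cst z 0) (row_derive_comp_line dg).
apply: is_derive_eq; rewrite E0 dotp0l addr0 gradyE jacyE; last exact: g_diff.
rewrite dotpDl -dotp_mulmx -{1}(hsubmxK (grad f _)) dotp_row_mx dotpC dotp0l add0r.
by rewrite dotpC -{1}(vsubmxK (jacobian g _)) mul_row_col mul0mx add0r.
Qed.

Lemma is_derive_prox_objective_th w th (v : 'rV[R]_m) : XYZ w -> Y th ->
  is_derive th v (prox_objective w : _ -> R^o)
    (dotp (dir_theta f g gamma1 (px w) (py w) (pz w) th) v).
Proof.
move=> ww Yth; have D := is_derive_lagrangian_y (pz w) v (XYZ_x ww) Yth.
have Dq : is_derive th v (fun th => enorm (th - py w) ^+ 2 : R^o) (2 * dotp (th - py w) v).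
  apply: is_derive_of_line; under eq_fun do rewrite sqr_enorm -addrA.
  have Dl := row_derive_line v (th - py w) 0.
  have := is_derive_dotp Dl Dl; rewrite scale0r add0r => Dd.
  by apply: is_derive_eq; rewrite dotpC; ring.
rewrite /prox_objective; apply: is_derive_eq.
by rewrite /dir_theta (dotpDl _ (gamma1^-1 *: _)) dotpZl /GRing.scale /=; field; rewrite gt_eqF.
Qed.

Let Lprox := Lf + r * Lg2 + gamma1^-1.

Let Lf_ge0 : 0 <= Lf.
Proof. by have [_ _ []] := f_assumption. Qed.

Let Lg2_ge0 : 0 <= Lg2.
Proof. by have [_ _ _ _ []] := g_assumption. Qed.

Let Lprox_ge0 : 0 <= Lprox.
Proof. by rewrite !addr_ge0 ?mulr_ge0 ?invr_ge0 // ltW. Qed.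

Let mxnorm_box z : @box R p r z -> `|z| <= r.
Proof.
move=> zb; rewrite [leLHS]/Num.Def.normr /= mx_normrE; apply: bigmax_le => // -[i j] _ /=.
by rewrite (ord1 i); have /andP[z0 zr] := zb j; rewrite ger0_norm.
Qed.

(** Since z has sup norm at most r on the box, [jac_norm] yields r Lg2 without a dimensional factor,
    and the constant is exactly the one bounding eta_k. *)
Lemma dir_theta_lip w th th' : XYZ w -> Y th -> Y th' ->
  enorm (dir_theta f g gamma1 (px w) (py w) (pz w) th
       - dir_theta f g gamma1 (px w) (py w) (pz w) th') <= Lprox * enorm (th - th').
Proof.
move=> ww Yth Yth'; have XYw := XY_row (XYZ_x ww) Yth; have XYw' := XY_row (XYZ_x ww) Yth'.
have -> : dir_theta f g gamma1 (px w) (py w) (pz w) th - dir_theta f g gamma1 (px w) (py w) (pz w) th'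
   = (grady f (px w) th - grady f (px w) th')
     + pz w *m (jacy g (px w) th - jacy g (px w) th')^T + gamma1^-1 *: (th - th').
  have aux (a b a' b' t t' y : 'rV[R]_m) (k : R) : a + b + k *: (t - y) - (a' + b' + k *: (t' - y))
      = (a - a') + (b - b') + k *: (t - t').
    by apply/rowP => i; rewrite !mxE; ring.
  by rewrite /dir_theta [(_ - _)^T]linearB mulmxBr aux.
have dE : enorm (row_mx (px w) th - row_mx (px w) th') = enorm (th - th').
  by rewrite opp_row_mx add_row_mx subrr enorm_row_0mx.
rewrite /Lprox !mulrDl (le_trans (ler_enormD _ _)) // lerD //; last first.
  by rewrite enormZ ger0_norm // invr_ge0 ltW.
rewrite (le_trans (ler_enormD _ _)) // lerD //.
  have [_ _ [_ /(_ _ _ XYw XYw')]] := f_assumption; rewrite dE.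
  by apply: le_trans; rewrite !gradyE -linearB enorm_rsubmx.
rewrite (le_trans (enorm_mulmx_jac _ _)) // -mulrA mulrC.
have zr := mxnorm_box (XYZ_z ww).
apply: (@le_trans _ _ (`|pz w| * (Lg2 * enorm (th - th')))).
  rewrite ler_wpM2l //.
  have [_ _ _ _ [_ /(_ _ _ XYw XYw')]] := g_assumption; rewrite dE.
  by rewrite !row_mxKl !row_mxKr.
by rewrite ler_wpM2r // mulr_ge0 // enorm_ge0.
Qed.

(** The upper bound is the descent lemma. For the lower one, the Lagrangian is convex in theta
    because z >= 0, and the prox term, being exactly quadratic, contributes the modulus 1 /
    gamma1. *)
Lemma prox_objective_scs w : XYZ w ->
  strongly_convex_smooth Y Lprox gamma1^-1 (prox_objective w)
    (dir_theta f g gamma1 (px w) (py w) (pz w)).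
Proof.
move=> ww a b Ya Yb; split; last first.
  apply: (descent_lemma Y_convex) => // [u v|u v].
    exact: is_derive_prox_objective_th.
  exact: dir_theta_lip.
have cl : convex_function Y (fun th => lagrangian f g (px w) th (pz w)).
  move=> t u v Yu Yv; have [fconv _ _] := f_assumption; have [gconv _ _ _ _] := g_assumption.
  rewrite /lagrangian convRE !mulrDr addrACA lerD //.
    by have := fconv _ (XYZ_x ww) t u v Yu Yv; rewrite convRE.
  rewrite /dotp !mulr_sumr -big_split; apply: ler_sum => i _ /=.
  have := gconv _ (XYZ_x ww) i t u v Yu Yv; rewrite convRE => h.
  have /andP[z0 _] := XYZ_z ww i.
  by apply: le_trans (ler_wpM2l z0 h) _; rewrite mulrDr !(mulrCA (pz w 0 i)).
have := convex_gradient_ineq Y_convex (fun th u => is_derive_lagrangian_y (pz w) u (XYZ_x ww)) cl Ya Yb.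
rewrite /prox_objective /dir_theta (dotpDl _ (gamma1^-1 *: _)) dotpZl.
have -> : enorm (b - py w) ^+ 2 = enorm (a - py w) ^+ 2 + 2 * dotp (a - py w) (b - a) + enorm (b - a) ^+ 2.
  rewrite !sqr_enorm !(dotpBr, dotpBl) (dotpC b a) (dotpC (py w) a) (dotpC (py w) b); ring.
have -> : (2 * gamma1)^-1 = gamma1^-1 / 2 by rewrite invfM mulrC.
lra.
Qed.

Lemma ex_prox_min w : XYZ w -> exists th, is_min Y (prox_objective w) th.
Proof.
move=> ww; have [||th] := @EVT_min_rV R m (prox_objective w) Y _ Y_compact.
- by exists (py w); exact: XYZ_y.
- apply: continuous_in_subspaceT => th; rewrite inE => Yth.
  (* Continuity in theta alone is read off the joint continuity at t = 0 with direction 0. *)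
  have C0 : ((0 : R), a) @[a --> th] --> ((0 : R), th).
    move=> S [[A B] /= [A0 Bth] AB]; apply: filterS Bth => a Ba.
    by apply: (AB (0, a)); split => //=; exact: nbhs_singleton.
  have := cvg_comp _ _ C0 (@cvg_prox_objective w 0 th ww Yth).
  by rewrite (_ : _ \o _ = prox_objective w) //; apply/funext => a /=; rewrite scaler0 add0r.
rewrite inE => Yth thmin; exists th; split => // a Ya.
by apply: thmin; rewrite inE.
Qed.

Lemma prox_min_uniq w th a : XYZ w -> is_min Y (prox_objective w) th ->
  Y a -> a != th -> prox_objective w th < prox_objective w a.
Proof.
move=> ww thP Ya ne; have m0 : 0 < gamma1^-1 by rewrite invr_gt0.
apply: lt_le_trans (is_min_growth Y_convex Lprox_ge0 (prox_objective_scs ww) thP Ya).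
rewrite ltrDl mulr_gt0 ?divr_gt0 // exprn_gt0 // lt_neqAle enorm_ge0 andbT.
apply: contra ne => /eqP e; rewrite -subr_eq0; apply/eqP/enorm_eq0; by rewrite -e.
Qed.

(** The blocks of the direction are regrouped into the terms that arise from differentiating F, the
    multiplier part and the prox part along [v]. *)
Lemma dotp_direction w th v : XYZ w -> Y th -> dotp (direction w th) v =
  c^-1 * dotp (grad F (lsubmx w)) (lsubmx v) + dotp (grad f (lsubmx w)) (lsubmx v)
  + dotp (multiplier w) (lsubmx v *m jacobian g (lsubmx w))
  + gamma2^-1 * dotp (multiplier w - pz w) (pz v) - prox_objective' w v 0 th.
Proof.
move=> ww Yth; have XYw := XY_row (XYZ_x ww) Yth.
have XYw0 : XY (row_mx (px w) (py w)) := XY_row (XYZ_x ww) (XYZ_y ww).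
have split2 a b (h : 'rV[R]_(a + b)) k : dotp h k = dotp (lsubmx h) (lsubmx k) + dotp (rsubmx h) (rsubmx k).
  by rewrite -dotp_row_mx !hsubmxK.
rewrite /prox_objective' scale0r add0r /direction /dir_x /dir_y /dir_z.
rewrite (split2 _ _ (row_mx _ _) v) row_mxKl row_mxKr.
rewrite (split2 _ _ (row_mx _ _) (lsubmx v)) row_mxKl row_mxKr.
rewrite !gradxE !gradyE !jacxE ?jacyE; try exact: g_diff.
rewrite !hsubmxK (dotpC (pz v)).
move: (jacobian g (lsubmx w)) (jacobian g (row_mx (px w) th)) => J1 J2.
move: (grad F (lsubmx w)) (grad f (lsubmx w)) (grad f (row_mx (px w) th)) => G1 G2 G3.
move: (multiplier w) (g (row_mx _ th)) (pz w) (py w) => l b z y.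
rewrite (split2 _ _ G1) (split2 _ _ G2) (split2 _ _ G3) row_mxKl row_mxKr.
have mulJ (k : 'rV[R]_(n + m)) (J : 'M[R]_(n + m, p)) e : dotp e (k *m J) =
    dotp (e *m (usubmx J)^T) (lsubmx k) + dotp (e *m (dsubmx J)^T) (rsubmx k).
  by rewrite -{1}(vsubmxK J) -{1}(hsubmxK k) mul_row_col dotpDr !dotp_mulmx.
rewrite !mulJ row_mxKl row_mxKr !(dotpC _ 0) !dotp0l.
rewrite !dotpDl !dotpNl !dotpZl !dotpDl !dotpNl.
by ring.
Qed.

(** * Gradient of the penalized objective *)

Let psi_at := psi Y F f g gamma1 gamma2 c.

Lemma is_derive_psi w th v : XYZ w -> is_min Y (prox_objective w) th ->
  is_derive w v (psi_at : _ -> R^o) (dotp (c *: direction w th) v).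
Proof.
move=> ww thP; have [Yth thmin] := thP.
have w0 : 0 *: v + w = w by rewrite scale0r add0r.
(* Taking [V] to be the difference, rather than a minimal value, keeps psi_c = F + c (A - V) valid
   for every [t], even where the line leaves X x Y x Z. *)
pose V t := gap_upper (t *: v + w) - gap_at (t *: v + w).
have DV : is_derive (0 : R) 1 (V : R -> R^o) (prox_objective' w v 0 th).
  apply: (@danskin R m Y (fun t => prox_objective (t *: v + w)) (prox_objective' w v) th V) => //.
  - by move=> a Ya ne; rewrite w0; exact: prox_min_uniq.
  - by move=> a Ya; rewrite w0; exact: cvg_prox_objective.
  - exact: near_is_derive_prox_objective.
  - exact: cvg_prox_objective'.
  - by move=> t l; exact: gap_bounds.
  - by rewrite /V w0 (gapE thP) subKr.
have [[Fdiff _] _ _] := F_assumption.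
have XYw : XY (lsubmx w) by case: ww.
have XYw0 : XY (0 *: lsubmx v + lsubmx w) by rewrite scale0r add0r.
have DF := is_derive_line (is_derive_grad (lsubmx v) (Fdiff _ XYw0)).
have Df := is_derive_line (is_derive_grad (lsubmx v) (f_diff XYw0)).
have Dl := row_derive_line (pz v) (pz w) 0.
have Da := row_deriveD Dl (row_deriveZ gamma2 (row_derive_comp_line (g_diff XYw0))).
have Dp := is_derive_pospart Da; have Dz := is_derive_dotp Dl Dl.
have upperE s : gap_upper (s *: v + w) = f (s *: lsubmx v + lsubmx w) + (2 * gamma2)^-1 *
   (enorm (pospart (s *: pz v + pz w + gamma2 *: g (s *: lsubmx v + lsubmx w))) ^+ 2
    - dotp (s *: pz v + pz w) (s *: pz v + pz w)).
  by rewrite /gap_upper /multiplier !hsubmxK !linearP -(sqr_enorm (_ + pz w)).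
apply: is_derive_of_line.
rewrite (_ : (fun s => _) = (fun s => F (s *: lsubmx v + lsubmx w) + c * (
   f (s *: lsubmx v + lsubmx w) + (2 * gamma2)^-1 *
   (enorm (pospart (s *: pz v + pz w + gamma2 *: g (s *: lsubmx v + lsubmx w))) ^+ 2
    - dotp (s *: pz v + pz w) (s *: pz v + pz w)) - V s))); last first.
  by apply/funext => s; rewrite -upperE /V subKr /psi_at /psi -/(gap_at (s *: v + w)) [in F _]linearP.
apply: is_derive_eq; rewrite dotpZl dotp_direction // !scale0r !add0r /GRing.scale /=.
rewrite /multiplier hsubmxK dotpDr dotpZr (dotpBl _ (pz w)) (dotpC (pz v)).
by field; rewrite !gt_eqF.
Qed.

Lemma grad_psi w th : XYZ w -> is_min Y (prox_objective w) th ->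
  grad psi_at w = c *: direction w th.
Proof. by move=> ww thP; apply: grad_is_derive => v; exact: is_derive_psi. Qed.

(** * Lipschitz continuity of the direction and of the exact minimizer *)

Let T := ('rV[R]_(n + m + p) * 'rV[R]_m)%type.
Let A : set T := [set q | XYZ q.1 /\ Y q.2].
Let d (s t : T) : R := enorm (s.1 - t.1) + enorm (s.2 - t.2).

Let d_ge0 s t : 0 <= d s t.
Proof. by rewrite addr_ge0 ?enorm_ge0. Qed.

Let d_bounded : exists D, forall s t, A s -> A t -> d s t <= D.
Proof.
have [MX MX0 XM] := compact_enorm_bounded X_compact.
have [MY MY0 YM] := compact_enorm_bounded Y_compact.
have zM (z : 'rV[R]_p) : box r z -> enorm z <= Num.sqrt p%:R * r.
  move=> zb; have := mxnorm_box zb => zr; apply: le_trans (enorm_le_mxnorm z) _.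
  by apply: ler_wpM2l => //; exact: sqrtr_ge0.
have wM w : XYZ w -> enorm w <= MX + MY + Num.sqrt p%:R * r.
  move=> ww; rewrite -(hsubmxK w) (le_trans (enorm_row_mx_le _ _)) // lerD ?zM //; last exact: XYZ_z.
  rewrite -(hsubmxK (lsubmx w)) (le_trans (enorm_row_mx_le _ _)) //.
  by rewrite lerD ?XM ?YM //; [exact: XYZ_x | exact: XYZ_y].
exists (2 * (MX + MY + Num.sqrt p%:R * r) + 2 * MY) => -[w a] [w' a'] [/= ww Ya] [/= ww' Ya'].
rewrite lerD //; apply: (le_trans (ler_enormB _ _)); rewrite mulr_natl mulr2n lerD ?wM //; exact: YM.
Qed.

Let lip_w : lip_on A d (fun q => q.1).
Proof. by exists 1 => // s t _ _; rewrite mul1r lerDl enorm_ge0. Qed.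

Let lip_th : lip_on A d (fun q => q.2).
Proof. by exists 1 => // s t _ _; rewrite mul1r lerDr enorm_ge0. Qed.

Let lip_px : lip_on A d (fun q => px q.1).
Proof. by do 2!apply: lip_on_lsubmx; exact: lip_w. Qed.

Let lip_py : lip_on A d (fun q => py q.1).
Proof. by apply: lip_on_rsubmx; apply: lip_on_lsubmx; exact: lip_w. Qed.

Let lip_pz : lip_on A d (fun q => pz q.1).
Proof. by apply: lip_on_rsubmx; exact: lip_w. Qed.

Section AlongPair.
Variables (a : T -> 'rV[R]_n) (b : T -> 'rV[R]_m).
Hypotheses (aX : forall q, A q -> X (a q)) (bY : forall q, A q -> Y (b q)).
Hypotheses (a_lip : lip_on A d a) (b_lip : lip_on A d b).

Let ab_lip : lip_on A d (fun q => row_mx (a q) (b q)).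
Proof. exact: lip_on_row_mx. Qed.

Let abXY q : A q -> XY (row_mx (a q) (b q)).
Proof. by move=> Aq; apply: XY_row; [exact: aX | exact: bY]. Qed.

(** The pair (a, b) stands for (x, y) or (x, theta), the two kinds of points at which the algorithm
    evaluates its data. *)
Lemma lip_gradx h L : smooth_on L XY h -> lip_on A d (fun q => gradx h (a q) (b q)).
Proof.
move=> hL; under eq_fun do rewrite gradxE.
by apply: lip_on_lsubmx; exact: (lip_on_comp hL).
Qed.

Lemma lip_grady h L : smooth_on L XY h -> lip_on A d (fun q => grady h (a q) (b q)).
Proof.
move=> hL; under eq_fun do rewrite gradyE.
by apply: lip_on_rsubmx; exact: (lip_on_comp hL).
Qed.

Lemma lip_g : lip_on A d (fun q => g (row_mx (a q) (b q))).
Proof. by have [_ gL _ _ _] := g_assumption; exact: (lip_on_comp gL). Qed.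

Lemma lip_jacx z : lip_on A d z -> lip_on A d (fun q => z q *m (jacx g (a q) (b q))^T).
Proof.
move=> zl; apply: lip_on_mulmx => //; have [_ _ _ gL _] := g_assumption.
apply: (mxlip_on_comp d_ge0 _ gL abXY ab_lip) => q.
by rewrite row_mxKl row_mxKr.
Qed.

Lemma lip_jacy z : lip_on A d z -> lip_on A d (fun q => z q *m (jacy g (a q) (b q))^T).
Proof.
move=> zl; apply: lip_on_mulmx => //; have [_ _ _ _ gL] := g_assumption.
apply: (mxlip_on_comp d_ge0 _ gL abXY ab_lip) => q.
by rewrite row_mxKl row_mxKr.
Qed.

End AlongPair.

Let AX q : A q -> X (px q.1). Proof. by case=> /XYZ_x. Qed.
Let AY q : A q -> Y (py q.1). Proof. by case=> /XYZ_y. Qed.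
Let Ath q : A q -> Y q.2. Proof. by case. Qed.

Let lip_multiplier : lip_on A d (fun q => multiplier q.1).
Proof.
apply: (lip_on_contract (@pospart_lip R p)); apply: lip_onD; first exact: lip_pz.
by apply: lip_onZ; exact: lip_g AX AY lip_px lip_py.
Qed.

Let lip_direction : lip_on A d (fun q => direction q.1 q.2).
Proof.
have [_ FL _] := F_assumption; have [_ _ fL] := f_assumption.
have gxF := lip_gradx AX AY lip_px lip_py FL; have gyF := lip_grady AX AY lip_px lip_py FL.
have gxf := lip_gradx AX AY lip_px lip_py fL; have gyf := lip_grady AX AY lip_px lip_py fL.
have gxt := lip_gradx AX Ath lip_px lip_th fL.
have jx := lip_jacx AX AY lip_px lip_py lip_multiplier.
have jy := lip_jacy AX AY lip_px lip_py lip_multiplier.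
have jt := lip_jacx AX Ath lip_px lip_th lip_pz.
have gt := lip_g AX Ath lip_px lip_th.
apply: lip_on_row_mx; first apply: lip_on_row_mx.
- apply: (lip_onB _ jt); apply: (lip_onB _ gxt); apply: (lip_onD _ jx).
  by apply: (lip_onD _ gxf); exact: lip_onZ.
- apply: lip_onB; last by apply: lip_onZ; apply: lip_onB; [exact: lip_py | exact: lip_th].
  by apply: (lip_onD _ jy); apply: (lip_onD _ gyf); exact: lip_onZ.
- apply: (lip_onB _ gt); apply: lip_onN; apply: lip_onZ.
  by apply: lip_onB; [exact: lip_pz | exact: lip_multiplier].
Qed.

Let lip_dir_theta :
  lip_on A d (fun q => dir_theta f g gamma1 (px q.1) (py q.1) (pz q.1) q.2).
Proof.
have [_ _ fL] := f_assumption.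
have gyt := lip_grady AX Ath lip_px lip_th fL.
have jt := lip_jacy AX Ath lip_px lip_th lip_pz.
apply: lip_onD; first exact: (lip_onD gyt jt).
by apply: lip_onZ; apply: lip_onB; [exact: lip_th | exact: lip_py].
Qed.

Lemma direction_lipschitz : exists2 L, 0 <= L & forall w w' a a',
  XYZ w -> XYZ w' -> Y a -> Y a' ->
  enorm (direction w a - direction w' a') <= L * (enorm (w - w') + enorm (a - a')).
Proof.
have [L L0 HL] := lip_direction; exists L => // w w' a a' ww ww' Ya Ya'.
exact: (HL (w, a) (w', a') (conj ww Ya) (conj ww' Ya')).
Qed.

(** [is_min_stable] compares the two prox gradients at the common point [a'], so only their
    dependence on [w] counts; the modulus 1 / gamma1 turns into the factor [gamma1]. *)
Lemma prox_min_lipschitz : exists2 L, 0 <= L & forall w w' a a',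
  XYZ w -> XYZ w' -> is_min Y (prox_objective w) a -> is_min Y (prox_objective w') a' ->
  enorm (a - a') <= L * enorm (w - w').
Proof.
have [L L0 HL] := lip_dir_theta; exists (gamma1 * L) => [|w w' a a' ww ww' aP aP'].
  by rewrite mulr_ge0 // ltW.
have m0 : 0 < gamma1^-1 by rewrite invr_gt0.
have := is_min_stable Y_convex Lprox_ge0 (prox_objective_scs ww) (prox_objective_scs ww') aP aP'.
rewrite ler_pdivrMl // => /le_trans; apply; rewrite -mulrA ler_wpM2l ?(ltW gamma1_gt0) //.
have := HL (w, a') (w', a') (conj ww aP'.1) (conj ww' aP'.1).
by rewrite /d /= subrr enorm0 addr0.
Qed.

Lemma psi_descent (argmin : 'rV[R]_(n + m + p) -> 'rV[R]_m) :
  (forall w, XYZ w -> is_min Y (prox_objective w) (argmin w)) ->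
  exists2 L, 0 <= L & forall w w', XYZ w -> XYZ w' ->
    psi_at w' <= psi_at w + c * dotp (direction w (argmin w)) (w' - w)
                 + L * enorm (w' - w) ^+ 2.
Proof.
move=> argminP; have [L1 L10 H1] := direction_lipschitz; have [L2 L20 H2] := prox_min_lipschitz.
pose L := c * (L1 * (1 + L2)).
have L0 : 0 <= L by rewrite !mulr_ge0 ?addr_ge0 // ltW.
exists (L / 2) => [|w w' ww ww']; first by rewrite divr_ge0.
rewrite -dotpZl.
apply: (@descent_lemma R _ XYZ psi_at (fun w => c *: direction w (argmin w))) => //.
  by move=> u v uu; apply: is_derive_psi => //; exact: argminP.
move=> u v uu vv; rewrite -scalerBr enormZ gtr0_norm // /L -mulrA ler_pM2l //.
have [Yu _] := argminP _ uu; have [Yv _] := argminP _ vv.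
rewrite (le_trans (H1 _ _ _ _ uu vv Yu Yv)) // -mulrA ler_wpM2l // mulrDl mul1r lerD2l.
by apply: H2 => //; exact: argminP.
Qed.

Lemma psi_lbound : exists M, forall w, XYZ w -> M <= psi_at w.
Proof.
have [_ _ [M HM]] := F_assumption; exists M => w ww.
have [th thP] := ex_prox_min ww.
rewrite /psi_at /psi -[M]addr0 lerD //; last by rewrite mulr_ge0 ?(ltW c_gt0) // (gap_ge0 ww thP).
by apply: HM; exists (lsubmx w) => //; case: ww.
Qed.

Lemma prox_step_contraction eta_lo : 0 < eta_lo ->
  exists2 rho, 0 <= rho < 1 & forall eta w s a b, XYZ w ->
    eta_lo < eta < Lprox^-1 -> is_min Y (prox_objective w) s -> Y a ->
    is_proj Y (a - eta *: dir_theta f g gamma1 (px w) (py w) (pz w) a) b ->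
    enorm (b - s) ^+ 2 <= rho * enorm (a - s) ^+ 2.
Proof.
(* With mu = 1 / gamma1, the ratio (1 - eta mu) / (1 + eta mu) is at most 1 / (1 + eta_lo mu),
   uniformly in eta. *)
move=> e0; pose rho := (1 + eta_lo * gamma1^-1)^-1.
have m0 : 0 < gamma1^-1 by rewrite invr_gt0.
have k0 : 0 < eta_lo * gamma1^-1 by rewrite mulr_gt0.
exists rho; first by rewrite invr_ge0 invf_lt1 ?ltrDl ?addr_ge0 ?(ltW k0) ?ltr_wpDl //= addr_gt0.
move=> eta w s a b ww /andP[e1 e2] sP Ya Pb.
have eta0 : 0 < eta := lt_trans e0 e1.
have Lp : 0 < Lprox by rewrite -invr_gt0 (lt_trans eta0).
have eL : eta * Lprox <= 1 by rewrite -ler_pdivlMr // mul1r ltW.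
have := projected_gradient_contraction Y_convex Lprox_ge0 (prox_objective_scs ww) sP Ya eta0 eL Pb.
rewrite /rho => C; rewrite ler_pdivlMl ?addr_gt0 //.
have : eta_lo * gamma1^-1 <= eta * gamma1^-1 by rewrite ler_pM2r // ltW.
have := sqr_ge0 (enorm (b - s)); have := sqr_ge0 (enorm (a - s)).
have : 0 <= eta * gamma1^-1 by rewrite mulr_ge0 // ltW.
move: (eta * _) (eta_lo * _) (enorm _ ^+ 2) (enorm _ ^+ 2) C => x y B1 B2; nra.
Qed.

(** * The iterates as projected steps in (x, y, z) *)

Section Iterates.
Variables (alpha eta : nat -> R) (x : nat -> 'rV[R]_n) (y : nat -> 'rV[R]_m).
Variables (z : nat -> 'rV[R]_p) (th : nat -> 'rV[R]_m) (la : nat -> 'rV[R]_p).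
Hypothesis alg : BiC_GAFFA X Y r F f g gamma1 gamma2 (fun=> c) alpha eta x y z th la.

Definition iterate k : 'rV[R]_(n + m + p) := row_mx (row_mx (x k) (y k)) (z k).

Lemma iterate_mem k : XYZ (iterate k).
Proof.
have [[x0 y0 z0 _] _ _ wP] := alg; case: k => [|k]; last by case: (wP k).
by split; rewrite /iterate ?row_mxKl ?row_mxKr //; exact: XY_row.
Qed.

Lemma inner_iterate_mem k : Y (th k).
Proof. by have [[_ _ _ t0] tP _ _] := alg; case: k => [//|k]; case: (tP k). Qed.

Lemma inner_iterate_proj k : is_proj Y
  (th k - eta k *: dir_theta f g gamma1 (px (iterate k)) (py (iterate k)) (pz (iterate k)) (th k))
  (th k.+1).
Proof.
have [_ tP _ _] := alg; rewrite /iterate !row_mxKl !row_mxKr; exact: tP.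
Qed.

Lemma iterate_proj k : is_proj XYZ
  (iterate k - alpha k *: direction (iterate k) (th k.+1)) (iterate k.+1).
Proof.
have [_ _ lP wP] := alg.
have lE : multiplier (iterate k) = la k.+1.
  rewrite /multiplier /iterate !row_mxKl !row_mxKr; exact/esym/is_proj_orthant.
by rewrite /direction lE /iterate !row_mxKl !row_mxKr; exact: wP.
Qed.

End Iterates.

(** * Residual estimates and square summability *)

Lemma residual_le x y z v s :
  let w := row_mx (row_mx x y) z in
  is_min Y (prox_objective w) s -> normal_cone XYZ w v ->
  residual X Y r F f g gamma1 gamma2 c x y z <= enorm (c *: direction w s + v).
Proof.
move=> w sP Nv; rewrite /residual /edist -/w; apply: ge_inf.
  by exists 0 => _ [u _ <-]; exact: enorm_ge0.
exists (grad (psi Y F f g gamma1 gamma2 c) w + v); first by exists v.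
by rewrite sub0r enormN -(grad_psi _ sP) //; case: Nv.
Qed.

Lemma residual_ge0 x y z : 0 <= residual X Y r F f g gamma1 gamma2 c x y z.
Proof.
rewrite /residual /edist; set E := [set _ | _ in _].
(* The [inf] of the empty set is 0 by default. *)
have [E0|E0] := pselect (E !=set0); last by rewrite inf_out // => -[].
by apply: lb_le_inf => // _ [u _ <-]; exact: enorm_ge0.
Qed.

Lemma sum_sqr_residual (eta_lo : R) (eta : nat -> R) : 0 < eta_lo ->
  (forall k, eta_lo < eta k < Lprox^-1) ->
  exists2 c_alpha, 0 < c_alpha &
    forall (alpha_lo : R) (alpha : nat -> R) (x : nat -> 'rV[R]_n) (y : nat -> 'rV[R]_m)
      (z : nat -> 'rV[R]_p) (th : nat -> 'rV[R]_m) (la : nat -> 'rV[R]_p), 0 < alpha_lo ->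
      (forall k, alpha_lo < alpha k < c_alpha) ->
      BiC_GAFFA X Y r F f g gamma1 gamma2 (fun=> c) alpha eta x y z th la ->
      exists Q, forall K, \sum_(k < K)
        residual X Y r F f g gamma1 gamma2 c (x k.+1) (y k.+1) (z k.+1) ^+ 2 <= Q.
Proof.
move=> eta_lo0 etaP.
(* A selection [s] of exact minimizers, with an arbitrary value outside X x Y x Z. *)
have /boolp.choice[s sP] : forall w, exists t, XYZ w -> is_min Y (prox_objective w) t.
  move=> w; have [/ex_prox_min[t tP]|nw] := pselect (XYZ w); first by exists t.
  by exists 0.
have [L1 L10 dirL] := direction_lipschitz.
have [L2 L20 sL] := prox_min_lipschitz.
have [L L0 desc] := psi_descent sP.
have [Plo psi_lo] := psi_lbound.
have [rho rho01 contr] := prox_step_contraction eta_lo0.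
have cL10 : 0 <= c * L1 by rewrite mulr_ge0 // ltW.
have [M [Al [M0 Al0 lyap]]] := lyapunov_decrease rho01 L20 cL10 L0.
(* A step below this bound has c / alpha_k above [Al], as the Lyapunov estimate requires; the 1
   keeps the denominator positive. *)
exists (c / (Al + 1)); first by rewrite divr_gt0 // ltr_wpDl.
move=> alpha_lo alpha x y z th la alpha_lo0 alphaP alg.
pose w := iterate x y z.
have ww k : XYZ (w k) := iterate_mem alg k.
pose D k := enorm (w k.+1 - w k).
pose e k := enorm (th k - s (w k)); pose e' k := enorm (th k.+1 - s (w k)).
have alpha0 k : 0 < alpha k by have /andP[al _] := alphaP k; exact: lt_trans al.
have e'e k : e' k ^+ 2 <= rho * e k ^+ 2.
  apply: (contr (eta k) (w k)) => //; [exact: sP | exact: inner_iterate_mem alg k |].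
  exact: inner_iterate_proj alg k.
have drift k : enorm (s (w k) - s (w k.+1)) <= L2 * D k.
  by rewrite /D enormBC; apply: sL => //; exact: sP.
have decrease k : psi_at (w k.+1) + M * e k.+1 ^+ 2 + (D k ^+ 2 + e k ^+ 2) <=
    psi_at (w k) + M * e k ^+ 2.
  apply: (lyap (c / alpha k) _ _ (e k) (e' k)); rewrite ?enorm_ge0 //.
  - have /andP[_ ac] := alphaP k; rewrite ler_pdivlMr // ltW //.
    apply: (@lt_trans _ _ ((Al + 1) * alpha k)); first by rewrite ltr_pM2r // ltrDl.
    by rewrite mulrC -ltr_pdivlMr // ltr_wpDl.
  - by rewrite (le_trans (ler_enorm_distD (s (w k)) _ _)) // lerD2l.
  have psiD := desc _ _ (ww k) (ww k.+1); apply: (le_trans psiD); rewrite -/(D k) lerD2r.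
  suff h : c * dotp (direction (w k) (s (w k))) (w k.+1 - w k) <=
      - (c / alpha k * D k ^+ 2) + c * L1 * e' k * D k.
    by rewrite -[leRHS]addrA lerD2l.
  set dl := w k.+1 - w k; set d1 := direction (w k) (th k.+1); set d0 := direction _ _.
  (* The projection inequality at w^(k+1) is tested with w^k. *)
  have vi : dotp d1 dl <= - (alpha k)^-1 * D k ^+ 2.
    have := is_proj_vi convex_XYZ (iterate_proj alg k) (ww k); rewrite -/w -/d1.
    have -> : w k - alpha k *: d1 - w k.+1 = - (dl + alpha k *: d1).
      by rewrite /dl opprD opprB addrAC.
    rewrite -(opprB (w k.+1) (w k)) -/dl dotpNr dotpNl opprK dotpDl dotpZl -sqr_enorm -/(D k).
    by move=> h; rewrite mulNr -mulrN ler_pdivlMl // -subr_le0 opprK addrC.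
  (* The price of using theta^(k+1) in place of the exact minimizer at w^k. *)
  have err : dotp (d0 - d1) dl <= L1 * e' k * D k.
    rewrite (le_trans (cauchy_schwarz _ _)) // ler_wpM2r ?enorm_ge0 //.
    have := dirL _ _ _ _ (ww k) (ww k) (sP _ (ww k)).1 (inner_iterate_mem alg k.+1).
    by rewrite subrr enorm0 add0r (enormBC (s _)).
  rewrite dotpBl in err.
  have -> : - (c / alpha k * D k ^+ 2) + c * L1 * e' k * D k =
    c * (- (alpha k)^-1 * D k ^+ 2 + L1 * e' k * D k) by ring.
  by rewrite ler_pM2l // -(subrK (dotp d1 dl) (dotp d0 dl)) addrC lerD.
have sumDe K : \sum_(k < K) (D k ^+ 2 + e k ^+ 2) <= psi_at (w 0%N) + M * e 0%N ^+ 2 - Plo.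
  apply: (sum_le_of_decrease (V := fun k => psi_at (w k) + M * e k ^+ 2)
    (h := fun k => D k ^+ 2 + e k ^+ 2)) => // k.
  by rewrite -[Plo]addr0 lerD ?psi_lo // mulr_ge0 ?sqr_ge0.
(* [c * L1] weighs the change of the direction, namely [D k] plus the drift [L2 * D k] plus [e k];
   the lower bound on the steps controls c / alpha_k. *)
pose B1 := c * L1 * (1 + L2) + c / alpha_lo; pose B2 := c * L1.
have B10 : 0 <= B1.
  by rewrite addr_ge0 ?mulr_ge0 ?addr_ge0 ?invr_ge0 // ltW.
have resB k : residual X Y r F f g gamma1 gamma2 c (x k.+1) (y k.+1) (z k.+1)
    <= B1 * D k + B2 * e k.
  (* A point minus its projection is normal at the projection; the scaling by c / alpha_k makes the
     old direction enter with weight c, opposite to the new gradient. *)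
  pose v := (c / alpha k) *: (w k - alpha k *: direction (w k) (th k.+1) - w k.+1).
  have ca0 : 0 < c / alpha k by rewrite divr_gt0.
  have Nv : normal_cone XYZ (w k.+1) v.
    split; first exact: ww.
    move=> u uu; rewrite dotpZl pmulr_rle0 //.
    exact: is_proj_vi convex_XYZ (iterate_proj alg k) uu.
  apply: (le_trans (residual_le (sP _ (ww k.+1)) Nv)).
  have -> : c *: direction (w k.+1) (s (w k.+1)) + v =
      c *: (direction (w k.+1) (s (w k.+1)) - direction (w k) (th k.+1))
      - (c / alpha k) *: (w k.+1 - w k).
    rewrite /v; move: (direction _ _) (direction _ _) => a b.
    apply/rowP => i; rewrite !mxE; field; rewrite gt_eqF //.
  rewrite (le_trans (ler_enormB _ _)) // !enormZ !gtr0_norm // -/(D k).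
  have h1 := dirL _ _ _ _ (ww k.+1) (ww k) (sP _ (ww k.+1)).1 (inner_iterate_mem alg k.+1).
  have h2 := ler_enorm_distD (s (w k)) (s (w k.+1)) (th k.+1).
  have h3 := drift k; rewrite enormBC in h3.
  have h4 : e' k <= e k.
    rewrite -(@ler_pXn2r _ 2) ?nnegrE ?enorm_ge0 // (le_trans (e'e k)) //.
    by rewrite ler_piMl ?sqr_ge0 //; case/andP: rho01 => _ /ltW.
  rewrite (enormBC (s (w k)) (th _)) -/(e' k) in h2; rewrite -/(D k) in h1.
  have h5 : c * enorm (direction (w k.+1) (s (w k.+1)) - direction (w k) (th k.+1)) <=
      c * (L1 * (D k + (L2 * D k + e k))).
    rewrite ler_pM2l // (le_trans h1) // ler_wpM2l // lerD2l (le_trans h2) // lerD //.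
  have h6 : c / alpha k * D k <= c / alpha_lo * D k.
    rewrite ler_wpM2r ?enorm_ge0 // ler_pM2l // lef_pV2 ?posrE //.
    by have /andP[/ltW] := alphaP k.
  rewrite /B1 /B2; lra.
(* The factor comes from (B1 D + B2 e)^2 <= 2 (B1^2 + B2^2) (D^2 + e^2), the rest from telescoping
   the Lyapunov function. *)
exists (2 * (B1 ^+ 2 + B2 ^+ 2) * (psi_at (w 0%N) + M * e 0%N ^+ 2 - Plo)) => K.
apply: le_trans (ler_wpM2l _ (sumDe K)); last by rewrite mulr_ge0 // addr_ge0 // sqr_ge0.
rewrite mulr_sumr; apply: ler_sum => k _.
have r0 := residual_ge0 (x k.+1) (y k.+1) (z k.+1).
have B0 : 0 <= B1 * D k + B2 * e k := le_trans r0 (resB k).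
apply: (@le_trans _ _ ((B1 * D k + B2 * e k) ^+ 2)); first by rewrite ler_pXn2r ?nnegrE.
have := sqr_ge0 (B1 * D k - B2 * e k).
have : 0 <= B1 ^+ 2 * e k ^+ 2 by rewrite mulr_ge0 ?sqr_ge0.
have : 0 <= B2 ^+ 2 * D k ^+ 2 by rewrite mulr_ge0 ?sqr_ge0.
move: (D k) (e k) => a b; lra.
Qed.

End Problem.

Theorem theorem4p4 (R : realType) (n m p : nat)
    (X : set 'rV[R]_n) (Y : set 'rV[R]_m) (r : R)
    (F f : 'rV[R]_(n + m) -> R) (g : 'rV[R]_(n + m) -> 'rV[R]_p)
    (LF Lf Lg Lg1 Lg2 gamma1 gamma2 c eta_lo : R) (eta : nat -> R)
    (X_closed : closed X) (X_convex : convex_set X)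
    (Y_closed : closed Y) (Y_convex : convex_set Y)
    (r_ge0 : 0 <= r)
    (F_assumption : upper_assumption X Y F LF)
    (f_assumption : lower_objective_assumption X Y f Lf)
    (g_assumption : constraint_assumption X Y g Lg Lg1 Lg2)
    (X_compact : compact X) (Y_compact : compact Y)
    (gamma1_gt0 : 0 < gamma1) (gamma2_gt0 : 0 < gamma2) (c_gt0 : 0 < c)
    (eta_lo_gt0 : 0 < eta_lo)
    (eta_bounds : forall k, eta_lo < eta k < (Lf + r * Lg2 + gamma1^-1)^-1) :
  exists c_alpha : R, 0 < c_alpha /\
    forall (alpha_lo : R) (alpha : nat -> R)
           (x : nat -> 'rV[R]_n) (y : nat -> 'rV[R]_m) (z : nat -> 'rV[R]_p)
           (th : nat -> 'rV[R]_m) (la : nat -> 'rV[R]_p),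
      0 < alpha_lo ->
      (forall k, alpha_lo < alpha k < c_alpha) ->
      BiC_GAFFA X Y r F f g gamma1 gamma2 (fun=> c) alpha eta x y z th la ->
      let res k :=
        residual X Y r F f g gamma1 gamma2 c (x k.+1) (y k.+1) (z k.+1) in
      (fun K : nat => \big[Num.min/res 0%N]_(k < K.+1) res k : R^o) =O_\oo
      (fun K : nat => (Num.sqrt (K%:R : R))^-1 : R^o).
Proof.
have [c_alpha c0 H] := sum_sqr_residual X_convex Y_convex r_ge0 X_compact Y_compact
  F_assumption f_assumption g_assumption gamma1_gt0 gamma2_gt0 c_gt0 eta_lo_gt0 eta_bounds.
exists c_alpha; split => // alpha_lo alpha x y z th la alo alphaP alg res.
have [Q resQ] := H _ _ _ _ _ _ _ alo alphaP alg.
by apply: bigmin_eqO_sqrt resQ => k; exact: residual_ge0.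
Qed.
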